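(* Let $n\ge 2$ and let $\mathcal{X}$ be the poset of quasi-parabolic hyperbolic structures on $F_n$ whose Busemann pseudocharacter is equivalent to $\chi_0$, identified with $\mathrm{Conf}^*_{\chi_0}(F_n)$. With the notation for $a$, $r$ and the subposets $\mathcal{LL}_t\subseteq\mathcal{X}$ given in the context, fix any $t_0\in(0,r)$ and let $I=[t_0,t_0.a)$. Then: (i) $\mathcal{X}$ has a largest element. (ii) $\mathcal{X}$ contains the uncountable family of subposets $\mathcal{LL}_t$ (the subposets of lamplike hyperbolic structures), indexed by $t$ in the real interval $I$. (iii) Each $\mathcal{LL}_t$ is upper (hence contains the largest element of $\mathcal{X}$), and has a smallest element, which is minimal in $\mathcal{X}$. These minimal elements are pairwise distinct, thus incomparable, for different values of $t\in I$. (iv) Each $\mathcal{LL}_t$ contains a copy of $\mathcal{P}(\mathbb{N})$. In fact, for all $t\ne t'$ in $I$, there are copies of $\mathcal{P}(\mathbb{N})$ contained in each of $\mathcal{LL}_t\setminus\mathcal{LL}_{t'}$, $\mathcal{LL}_{t'}\setminus\mathcal{LL}_t$ and $\mathcal{LL}_t\cap\mathcal{LL}_{t'}$.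
   Context: **The groups.** $F_n$ is the group of all piecewise linear orientation preserving homeomorphisms of $[0,1]$ with all slopes powers of $n$ and breakpoints in $\mathbb{Z}[1/n]$, acting on the right ($x.(gh)=(x.g).h$); $F_n'$ is its commutator subgroup; $\chi_0(g)=\log_n g'(0)$, $\chi_1(g)=\log_n g'(1)$. Conjugation is $x^y=y^{-1}xy$. Fix elements $a_0,\dots,a_{n-1}\in F_n$ such that $a_i$ has support a single open interval $(\ell_i,r_i)$, $\ell_0=0$, $\chi_0(a_0)=1$, $r_{n-1}=1$, $\chi_1(a_{n-1})=1$, $r_{i-1}<\ell_i$ for $1\le i\le n-1$, and the $a_i$ generate the abelianization $F_n/F_n'\cong\mathbb{Z}^n$ (such elements exist). They commute, so $F_n=F_n'\rtimes\mathbb{Z}^n$ with $\mathbb{Z}^n=\langle a_0,\dots,a_{n-1}\rangle$. Put $a=a_0$, $r=r_0$, $\chi=\chi_0$; on $\mathbb{Z}^n$, $\chi(\prod a_i^{k_i})=k_0$. **Confining subsets.** A subset $Q\subseteq F_n'$ is $\chi$-confining if $Q=Q^{-1}$ and: $Q^z\subseteq Q$ for all $z\in\mathbb{Z}^n$ with $\chi(z)\ge0$; for every $h\in F_n'$ there is $z\in\mathbb{Z}^n$ with $h^z\in Q$; and there is $z_0\in\mathbb{Z}^n$ with $(Q\cdot Q)^{z_0}\subseteq Q$. It is strictly $\chi$-confining if moreover $Q^z\subsetneq Q$ for some $z\in\mathbb{Z}^n$. Let $Z_\chi=\{z\in\mathbb{Z}^n: |\chi(z)|\le1\}$. Write $Q_1\preceq_\chi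 Q_2$ if the elements of $Q_2$ have uniformly bounded word length with respect to the generating set $Q_1\cup Z_\chi$ of $F_n$. This is a preorder; $\mathrm{Conf}^*_\chi(F_n)$ is the induced poset of equivalence classes $[Q]$ of strictly $\chi$-confining subsets. The map $[Q]\mapsto[F_n\curvearrowright\mathrm{Cay}(F_n,Q\cup Z_\chi)]$ identifies $\mathrm{Conf}^*_\chi(F_n)$ with the poset of equivalence classes of cobounded quasi-parabolic actions of $F_n$ on hyperbolic spaces whose Busemann pseudocharacter is a positive multiple of $\chi_0$. **Lamplike.** For $t\in(0,r)$, $\mathcal{LL}_t$ is the subposet of $\mathrm{Conf}^*_\chi(F_n)$ of classes having a representative $Q$ all of whose elements fix $t$. **Posets.** A subset $S$ of a poset is upper if every element dominating (i.e. $\succcurlyeq$) an element of $S$ lies in $S$. $\mathcal{P}(\mathbb{N})$ is the power set ordered by inclusion; a copy of it is the image of an order embedding. An element is minimal if it dominates no other element. *)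

(* Defs.v *)
From HB Require Import structures.
From mathcomp Require Import all_boot all_order all_algebra.
From mathcomp Require Import all_classical all_reals all_analysis.

Set Implicit Arguments.
Unset Strict Implicit.
Unset Printing Implicit Defensive.

Import Order.TTheory GRing.Theory Num.Theory.
Import numFieldNormedType.Exports.

Local Open Scope classical_set_scope.

Section Words.
Local Open Scope group_scope.
Context {G : groupType}.
Implicit Types (S : set G) (g : G).

(* The elements of word length at most k with respect to S *)
Definition word_ball S (k : nat) : set G :=
  [set g | exists w : seq G,
    [/\ (size w <= k)%N,
        forall s, s \in w -> S s \/ S s^-1 &
        g = \prod_(s <- w) s]].

Definition generated S : set G := \bigcup_k word_ball S k.

Definition derived_subgroup : set G :=
  generated [set g | exists x y : G, g = [~ x, y]].

Lemma word_ball_sub S S' k k' :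
  S `<=` S' -> (k <= k')%N -> word_ball S k `<=` word_ball S' k'.
Proof.
move=> SS' kk' g [w [sw wS ->]]; exists w; split => //.
- exact: leq_trans kk'.
- by move=> s /wS[] /SS'; [left|right].
Qed.

Lemma word_ball_mul S k k' g g' :
  word_ball S k g -> word_ball S k' g' -> word_ball S (k + k') (g * g').
Proof.
move=> [w [sw wS ->]] [w' [sw' wS' ->]]; exists (w ++ w'); split.
- by rewrite size_cat leq_add.
- by move=> s; rewrite mem_cat => /orP[/wS|/wS'].
- by rewrite big_cat.
Qed.

Lemma word_ball_inv S k g : word_ball S k g -> word_ball S k g^-1.
Proof.
move=> [w]; elim: w k g => [|x w IH] k g [sw wS ->].
  by exists [::]; split => //; rewrite big_nil invg1.
rewrite big_cons invgM; case: k sw => // k sw.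
rewrite -[k.+1]addn1; apply: word_ball_mul.
  by apply: IH; split => // s sw'; apply: wS; rewrite in_cons sw' orbT.
exists [:: x^-1]; split => //.
  move=> s; rewrite inE => /eqP ->; rewrite invgK.
  by case: (wS x); rewrite ?mem_head //; [right|left].
by rewrite big_seq1.
Qed.

Lemma word_ball_trans S S' k m : S' `<=` word_ball S k ->
  word_ball S' m `<=` word_ball S (m * k).
Proof.
move=> S'S g [w]; elim: w m g => [|x w IH] m g [sw wS ->].
  by exists [::]; split => //; rewrite big_nil.
rewrite big_cons; case: m sw => // m sw; rewrite mulSn.
apply: word_ball_mul.
  case: (wS x); rewrite ?mem_head //; first exact: S'S.
  by move=> /S'S/word_ball_inv; rewrite invgK.
by apply: IH; split => // s sw'; apply: wS; rewrite in_cons sw' orbT.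
Qed.

End Words.

Local Open Scope ring_scope.

Section ThompsonGroups.
Context {R : realType}.
Implicit Types (f : R -> R) (n : nat).

(* The ring Z[1/n], as a subset of R: x = m / n^k with m an integer, written
   without division. *)
Definition Zinv n : set R :=
  [set x | exists k : nat, x * n%:R ^+ k \is a Num.int].

Definition homeomorphism f : Prop :=
  exists f', [/\ cancel f f', cancel f' f, continuous f & continuous f'].

Definition affine_between n f (u v : R) : Prop :=
  exists k : int, {in `[u, v] &, forall x y, f y - f x = n%:R ^ k * (y - x)}.

(* f is piecewise linear on [0,1], with slopes powers of n and with all its
   breakpoints in the finite subset B of Z[1/n]. *)
Definition PL n f : Prop :=
  exists2 B : seq R, (forall b, b \in B -> Zinv n b) &
    forall u v, 0 <= u -> u < v -> v <= 1 ->
      (forall b, b \in B -> b \notin `]u, v[) -> affine_between n f u v.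

(* A homeomorphism of [0,1] fixing 0 and 1 is encoded by its extension to R by
   the identity. *)
Definition in_F n f : Prop :=
  [/\ homeomorphism f, {homo f : x y / x < y},
      forall x, x \notin `]0, 1[ -> f x = x & PL n f].

Record F n := MkF { Ffun :> R -> R; _ : in_F n Ffun }.

Lemma FP n (g : F n) : in_F n g. Proof. by case: g. Qed.

Lemma F_inj n (g h : F n) : (forall x, g x = h x) -> g = h.
Proof.
case: g h => [g gF] [h hF] /= /funext gh; case: _ / gh in hF *.
by congr MkF; exact: Prop_irrelevance.
Qed.

Lemma Zinv0 n : Zinv n 0. Proof. by exists 0%N; rewrite mul0r. Qed.

Lemma ZinvD n x y : Zinv n x -> Zinv n y -> Zinv n (x + y).
Proof.
move=> [k xk] [l yl]; exists (k + l)%N.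
rewrite mulrDl exprD mulrA [_ ^+ k * _ as X in _ * X]mulrC mulrA.
have nint m : (n%:R ^+ m : R) \is a Num.int by rewrite rpredX // rpred_nat.
by rewrite rpredD // rpredM.
Qed.

Lemma ZinvN n x : Zinv n x -> Zinv n (- x).
Proof. by move=> [k xk]; exists k; rewrite mulNr rpredN. Qed.

Lemma ZinvM n x y : Zinv n x -> Zinv n y -> Zinv n (x * y).
Proof. by move=> [k xk] [l yl]; exists (k + l)%N; rewrite exprD mulrACA rpredM. Qed.

Lemma Zinv_exp n (k : int) : Zinv n (n%:R ^ k).
Proof.
case: k => k; first by exists 0%N; rewrite mulr1 rpredX // rpred_nat.
exists k.+1; rewrite NegzE -exprnN.
have [->|n0] := eqVneq (n%:R ^+ k.+1 : R) 0; first by rewrite mulr0.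
by rewrite mulVf.
Qed.

Lemma exp_mul n (k l : int) : n%:R ^ k != 0 :> R -> n%:R ^ l != 0 :> R ->
  exists m : int, n%:R ^ k * n%:R ^ l = n%:R ^ m :> R.
Proof.
have [->|n0] := eqVneq n 0%N.
  have [->|] := eqVneq l 0; first by exists k; rewrite expr0z mulr1.
  by move=> l0; rewrite [0 ^ l]exp0rz (negPf l0) eqxx.
by move=> _ _; exists (k + l); rewrite expfzDr // pnatr_eq0.
Qed.

Lemma in_F_le n f : in_F n f -> {mono f : x y / x <= y}.
Proof. by move=> [_ fm _ _]; exact: le_mono. Qed.

Lemma in_F_lt n f : in_F n f -> {mono f : x y / x < y}.
Proof. by move=> /in_F_le /leW_mono. Qed.

Lemma in_F_fix n f : in_F n f -> (f 0 = 0) * (f 1 = 1).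
Proof. by move=> [_ _ fid _]; rewrite !fid // in_itv /= ltxx ?andbF. Qed.

Lemma in_F_bnd n f x : in_F n f ->
  ((0 <= f x) = (0 <= x)) * ((f x <= 1) = (x <= 1)).
Proof.
by move=> fF; rewrite -(in_F_le fF 0 x) -(in_F_le fF x 1) !(in_F_fix fF).
Qed.

Lemma slope_neq0 n f (k : int) u v : in_F n f -> u < v ->
  {in `[u, v] &, forall x y, f y - f x = n%:R ^ k * (y - x)} ->
  n%:R ^ k != 0 :> R.
Proof.
move=> /in_F_lt fm uv /(_ u v); rewrite !in_itv /= !lexx !ltW // => /(_ isT isT).
move=> e; apply/eqP => k0; move: e; rewrite k0 mul0r => /eqP.
by rewrite subr_eq0 => /eqP e; move: uv; rewrite -fm e ltxx.
Qed.

Lemma prev_point (B : seq R) x : 0 < x -> exists b,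
  [/\ b \in 0 :: B, 0 <= b, b < x & forall c, c \in B -> c \notin `]b, x[].
Proof.
move=> x0; elim: B => [|c B [b [bB b0 bx bP]]].
  by exists 0; rewrite mem_head.
have [cb|cb] := boolP (c \in `]b, x[).
  move: cb; rewrite in_itv /= => /andP[bc cx]; exists c; split => //.
  - by rewrite !inE eqxx orbT.
  - exact: le_trans (ltW bc).
  move=> d; rewrite inE => /orP[/eqP ->|/bP]; first by rewrite in_itv /= ltxx.
  apply: contra; rewrite !in_itv /= => /andP[cd ->].
  by rewrite (lt_trans bc).
exists b; split => //.
  by move: bB; rewrite !inE => /orP[->//|->]; rewrite !orbT.
by move=> d; rewrite inE => /orP[/eqP ->|/bP].
Qed.

Lemma F_Zinv n f x : in_F n f -> 0 <= x <= 1 -> Zinv n (f x) <-> Zinv n x.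
Proof.
move=> fF; have [_ fm fid [B BZ BP]] := fF.
have [m] := ubnP (count (< x) (0 :: B)).
elim: m x => // m IH x; rewrite ltnS => cm /andP[x0 x1].
move: x0; rewrite le_eqVlt => /orP[/eqP <-|x0].
  by rewrite fid // in_itv /= ltxx.
have [b [bB b0 bx bP]] := prev_point B x0.
have [k kP] := BP _ _ b0 bx x1 bP.
have k0 := slope_neq0 fF bx kP.
have e : f x - f b = n%:R ^ k * (x - b).
  by apply: kP; rewrite in_itv /= lexx ltW.
have bZ : Zinv n b.
  by move: bB; rewrite inE => /orP[/eqP ->|/BZ//]; exact: Zinv0.
have fbZ : Zinv n (f b).
  apply/IH => //; last by rewrite b0 (le_trans (ltW bx)).
  apply: leq_trans cm; rewrite -!size_filter.
  apply: (@leq_trans (size [seq y <- 0 :: B | (y == b) || (y < b)])).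
    rewrite !size_filter -[X in (_ < X)%N]addn0.
    rewrite -(count_pred0 (0 :: B)).
    rewrite (eq_count (a1 := pred0) (a2 := predI (pred1 b) (< b))); last first.
      by move=> y /=; case: eqP => //= ->; rewrite ltxx.
    rewrite count_predUI -[X in (X < _)%N]add0n ltn_add2r -has_count.
    by apply/hasP; exists b => //=.
  rewrite !size_filter; apply: sub_count => y /= /orP[/eqP ->//|yb].
  exact: lt_trans bx.
split=> H.
  have -> : x = b + (n%:R ^ k)^-1 * (f x - f b) by rewrite e mulKf // addrC subrK.
  by apply: ZinvD => //; apply: ZinvM; [rewrite invr_expz; exact: Zinv_exp
     |apply: ZinvD => //; exact: ZinvN].
have -> : f x = f b + n%:R ^ k * (x - b) by rewrite -e addrC subrK.
apply: ZinvD => //; apply: ZinvM; first exact: Zinv_exp.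
by apply: ZinvD => //; exact: ZinvN.
Qed.

Lemma in_F_id n : in_F n id.
Proof.
split => //; first by exists id; split => // x; exact: cvg_id.
by exists [::] => // u v *; exists 0 => x y _ _; rewrite expr0z mul1r.
Qed.

Lemma homeomorphism_comp f h :
  homeomorphism f -> homeomorphism h -> homeomorphism (h \o f).
Proof.
move=> [f' [fK f'K fc f'c]] [h' [hK h'K hc h'c]]; exists (f' \o h'); split.
- exact: can_comp.
- exact: can_comp.
- by move=> x; apply: continuous_comp; [exact: fc|exact: hc].
- by move=> x; apply: continuous_comp; [exact: h'c|exact: f'c].
Qed.

Lemma in_F_comp n f h : in_F n f -> in_F n h -> in_F n (h \o f).
Proof.
move=> fF hF.
have [fH fm fid [B BZ BP]] := fF; have [hH hm hid [C CZ CP]] := hF.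
split; first exact: homeomorphism_comp.
- by move=> x y /fm/hm.
- by move=> x xI /=; rewrite fid // hid.
have [f' [fK f'K _ _]] := fH.
exists (B ++ [seq f' c | c <- C & c \in `[0, 1]]).
  move=> b; rewrite mem_cat => /orP[/BZ//|/mapP[c]].
  rewrite mem_filter => /andP[c01 /CZ cZ ->].
  apply/(F_Zinv fF); last by rewrite f'K.
  by rewrite -(in_F_bnd (f' c) fF).1 -(in_F_bnd (f' c) fF).2 f'K; move: c01; rewrite in_itv.
move=> u v u0 uv v1 avoid.
have [k kP] : affine_between n f u v.
  by apply: BP => // b bB; apply: avoid; rewrite mem_cat bB.
have [l lP] : affine_between n h (f u) (f v).
  apply: CP; rewrite ?(in_F_bnd _ fF) ?(in_F_lt fF) // => c cC.
  apply/negP; rewrite in_itv /= => /andP[uc cv].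
  have c01 : c \in `[0, 1].
    rewrite in_itv /= (le_trans _ (ltW uc)) ?(le_trans (ltW cv)) //;
    by rewrite (in_F_bnd _ fF).
  have /avoid/negP[] : f' c \in B ++ [seq f' c | c <- C & c \in `[0, 1]].
    by rewrite mem_cat map_f ?orbT // mem_filter c01.
  by rewrite in_itv /= -(in_F_lt fF u) -(in_F_lt fF _ v) f'K uc.
have fuv : f u < f v by rewrite (in_F_lt fF).
have [m mE] := exp_mul (slope_neq0 hF fuv lP) (slope_neq0 fF uv kP).
exists m => x y xI yI /=; rewrite lP ?kP //; first by rewrite mulrA mE.
- by move: xI; rewrite !in_itv /= !(in_F_le fF).
- by move: yI; rewrite !in_itv /= !(in_F_le fF).
Qed.

Lemma F_inv_subproof n (g : F n) :
  exists f', [/\ cancel g f', cancel f' g & in_F n f'].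
Proof.
have gF := FP g; have [[f' [gK f'K gc f'c]] gm gid [B BZ BP]] := gF.
exists f'; split => //; split.
- by exists g.
- by move=> x y xy; rewrite -(in_F_lt gF) !f'K.
- by move=> x xI; apply: (can_inj gK); rewrite f'K gid.
exists [seq g b | b <- B & b \in `[0, 1]].
  move=> y /mapP[b]; rewrite mem_filter => /andP[b01 /BZ bZ ->].
  by apply/(F_Zinv gF) => //; move: b01; rewrite in_itv.
move=> u v u0 uv v1 avoid.
have uv' : f' u < f' v by rewrite -(in_F_lt gF) !f'K.
have u0' : 0 <= f' u by rewrite -(in_F_bnd _ gF).1 f'K.
have v1' : f' v <= 1 by rewrite -(in_F_bnd _ gF).2 f'K.
have [k kP] : affine_between n g (f' u) (f' v).
  apply: BP => // b bB; apply/negP; rewrite in_itv /= => /andP[ub bv].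
  have /avoid/negP[] : g b \in [seq g b | b <- B & b \in `[0, 1]].
    rewrite map_f // mem_filter bB in_itv /= (le_trans u0' (ltW ub)).
    by rewrite (le_trans (ltW bv)).
  by rewrite in_itv /= -[u]f'K -[v]f'K !(in_F_lt gF) ub.
have k0 := slope_neq0 gF uv' kP.
exists (- k) => x y xI yI; rewrite -{2}[x]f'K -{2}[y]f'K kP; last 2 first.
- by rewrite in_itv /= -(in_F_le gF (f' u)) -(in_F_le gF _ (f' v)) !f'K.
- by rewrite in_itv /= -(in_F_le gF (f' u)) -(in_F_le gF _ (f' v)) !f'K.
by rewrite -invr_expz mulKf.
Qed.

Definition F_inv n (g : F n) : F n :=
  MkF (let: And3 _ _ f'F := svalP (cid (F_inv_subproof g)) in f'F).

Lemma F_invK n (g : F n) : cancel (F_inv g) g /\ cancel g (F_inv g).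
Proof. by have [gK f'K _] := svalP (cid (F_inv_subproof g)). Qed.

Definition F_one n : F n := MkF (in_F_id n).

(* Right action: x.(gh) = (x.g).h, where x.g is written g x *)
Definition F_mul n (g h : F n) : F n := MkF (in_F_comp (FP g) (FP h)).

HB.instance Definition _ n := gen_eqMixin (F n).
HB.instance Definition _ n := gen_choiceMixin (F n).

Lemma F_mulA n : associative (@F_mul n).
Proof. by move=> g h k; apply: F_inj. Qed.
Lemma F_mul1 n : left_id (F_one n) (@F_mul n).
Proof. by move=> g; apply: F_inj. Qed.
Lemma F_mulr1 n : right_id (F_one n) (@F_mul n).
Proof. by move=> g; apply: F_inj. Qed.
Lemma F_mulV n : left_inverse (F_one n) (@F_inv n) (@F_mul n).
Proof. by move=> g; apply: F_inj => x; exact: (F_invK g).1. Qed.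
Lemma F_mulrV n : right_inverse (F_one n) (@F_inv n) (@F_mul n).
Proof. by move=> g; apply: F_inj => x; exact: (F_invK g).2. Qed.

HB.instance Definition _ n := isGroup.Build (F n)
  (@F_mulA n) (@F_mul1 n) (@F_mulr1 n) (@F_mulV n) (@F_mulrV n).

Lemma F_mulE n (g h : F n) x : (g * h)%g x = h (g x).
Proof. by []. Qed.

Definition supp n (g : F n) : set R := [set x | g x != x].

(* chi0 and chi1 only involve the one-sided derivatives taken from inside
   [0,1]. *)
Definition chi0 n (g : F n) : R :=
  ln (lim ((g (0 + e) - g 0) / e @[e --> 0^'+])) / ln n%:R.

Definition chi1 n (g : F n) : R :=
  ln (lim ((g (1 + e) - g 1) / e @[e --> 0^'-])) / ln n%:R.

End ThompsonGroups.
Arguments F R n : clear implicits.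

Section ConfiningSubsets.
Context {R : realType} {n : nat}.
Implicit Types (a : nat -> F R n) (Q : set (F R n)) (z : F R n).

(* The values of a, l and r at indices >= n are irrelevant. *)
Definition Zn a : set (F R n) := generated (a @` `I_n).

(* Generation of the abelianization F_n / F_n' is expressed modulo F_n'. *)
Definition standard_elements a (l r : nat -> R) : Prop :=
  [/\ forall i, (i < n)%N -> l i < r i /\ supp (a i) = `]l i, r i[%classic,
      l 0%N = 0 /\ chi0 (a 0%N) = 1,
      r n.-1 = 1 /\ chi1 (a n.-1) = 1,
      forall i, (1 <= i <= n.-1)%N -> r i.-1 < l i &
      forall g : F R n, exists2 z, Zn a z & derived_subgroup (z^-1 * g)%g].

Definition conj_set Q z : set (F R n) := [set (q ^ z)%g | q in Q].

Definition confining a Q : Prop :=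
  [/\ Q `<=` derived_subgroup,
      Q = [set (q^-1)%g | q in Q],
      forall z, Zn a z -> 0 <= chi0 z -> conj_set Q z `<=` Q,
      forall h, derived_subgroup h -> exists2 z, Zn a z & Q (h ^ z)%g &
      exists2 z0, Zn a z0 &
        conj_set [set (p * q)%g | p in Q & q in Q] z0 `<=` Q].

Definition strictly_confining a Q : Prop :=
  confining a Q /\ exists2 z, Zn a z & conj_set Q z `<` Q.

Definition Zchi a : set (F R n) := [set z | Zn a z /\ `|chi0 z| <= 1].

(* Q1 precedes Q2 when Q2 has bounded word length with respect to Q1 and Zchi,
   so that larger confining subsets are smaller in this preorder. *)
Definition conf_le a Q1 Q2 : Prop :=
  exists k, Q2 `<=` word_ball (Q1 `|` Zchi a) k.

Record strict_conf a := StrictConf {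
  conf_set :> set (F R n); _ : strictly_confining a conf_set }.

HB.instance Definition _ a := gen_eqMixin (strict_conf a).
HB.instance Definition _ a := gen_choiceMixin (strict_conf a).

Lemma conf_le_refl a Q : conf_le a Q Q.
Proof.
exists 1%N => q Qq; exists [:: q]; split => //; last by rewrite big_seq1.
by move=> s; rewrite inE => /eqP ->; left; left.
Qed.

Lemma conf_le_trans a Q1 Q2 Q3 :
  conf_le a Q1 Q2 -> conf_le a Q2 Q3 -> conf_le a Q1 Q3.
Proof.
move=> [k kP] [m mP]; exists (m * k.+1)%N; apply: subset_trans mP _.
apply: word_ball_trans => q [/kP|Zq]; first exact: word_ball_sub.
exists [:: q]; split => //; last by rewrite big_seq1.
by move=> s; rewrite inE => /eqP ->; left; right.
Qed.

Definition conf_equiv a : rel (strict_conf a) :=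
  fun Q1 Q2 : strict_conf a => `[< conf_le a Q1 Q2 /\ conf_le a Q2 Q1 >].

Lemma conf_equiv_refl a : reflexive (@conf_equiv a).
Proof. by move=> P; apply/asboolP; split; exact: conf_le_refl. Qed.

Lemma conf_equiv_sym a : symmetric (@conf_equiv a).
Proof. by move=> P Q; apply/asboolP/asboolP => -[]. Qed.

Lemma conf_equiv_trans a : transitive (@conf_equiv a).
Proof.
move=> Q P S /asboolP[PQ QP] /asboolP[QS SQ]; apply/asboolP.
by split; apply: (@conf_le_trans _ _ Q).
Qed.

Canonical conf_equiv_rel a := EquivRel (@conf_equiv a)
  (@conf_equiv_refl a) (@conf_equiv_sym a) (@conf_equiv_trans a).

(* The poset Conf*_chi; its order is described on representatives by Conf_leE. *)
Definition Conf a := {eq_quot (conf_equiv_rel a)}%qT.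
HB.instance Definition _ a := EqQuotient.on (Conf a).
HB.instance Definition _ a := Choice.on (Conf a).

Definition conf_class a (Q : strict_conf a) : Conf a := \pi_(Conf a)%qT Q.

Definition Conf_le a (x y : Conf a) : bool :=
  `[< conf_le a (repr x) (repr y) >].

Lemma conf_classP a (P Q : strict_conf a) :
  conf_class P = conf_class Q <-> conf_le a P Q /\ conf_le a Q P.
Proof. by split => [/eqmodP/asboolP//|PQ]; apply/eqmodP/asboolP. Qed.

Lemma conf_classK a (x : Conf a) : conf_class (repr x) = x.
Proof. exact: reprK. Qed.

Lemma Conf_leE a (P Q : strict_conf a) :
  Conf_le (conf_class P) (conf_class Q) <-> conf_le a P Q.
Proof.
have /conf_classP[P1 P2] := conf_classK (conf_class P).
have /conf_classP[Q1 Q2] := conf_classK (conf_class Q).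
split=> [/asboolP h|h]; last apply/asboolP.
  exact: conf_le_trans (conf_le_trans P2 h) Q1.
exact: conf_le_trans (conf_le_trans P1 h) Q2.
Qed.

Lemma Conf_le_refl a : reflexive (@Conf_le a).
Proof. by move=> x; apply/asboolP; exact: conf_le_refl. Qed.

Lemma Conf_le_anti a : antisymmetric (@Conf_le a).
Proof.
move=> x y /andP[/asboolP xy /asboolP yx].
by rewrite -(conf_classK x) -(conf_classK y); apply/conf_classP.
Qed.

Lemma Conf_le_trans a : transitive (@Conf_le a).
Proof.
move=> y x z /asboolP xy /asboolP yz; apply/asboolP.
exact: conf_le_trans xy yz.
Qed.

HB.instance Definition _ a := Order.Le_isPOrder.Build Order.default_display
  (Conf a) (@Conf_le_refl a) (@Conf_le_anti a) (@Conf_le_trans a).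

Definition LL a (t : R) : set (Conf a) :=
  [set x | exists Q : strict_conf a,
    x = conf_class Q /\ forall q, conf_set Q q -> q t = t].

End ConfiningSubsets.
Arguments LL {R n} a t.

Section Posets.
Local Open Scope order_scope.
Context {d : Order.disp_t} {X : porderType d}.
Implicit Types (S : set X) (x m : X).

Definition is_upper S : Prop := forall x y, S x -> x <= y -> S y.
Definition is_smallest S m : Prop := S m /\ forall x, S x -> m <= x.
Definition is_largest S m : Prop := S m /\ forall x, S x -> x <= m.
Definition is_minimal m : Prop := forall x, x <= m -> x = m.

(* A copy of P(N) is the image of an order embedding f of P(N). *)
Definition contains_powerset_nat S : Prop :=
  exists f : set nat -> X, (forall A, S (f A)) /\
    forall A B, f A <= f B <-> A `<=` B.

End Posets.

(* Main.v *)
Require Import Defs.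
From HB Require Import structures.
From mathcomp Require Import all_boot all_order all_algebra.
From mathcomp Require Import all_classical all_reals all_analysis.
From mathcomp Require Import lra zify ring.

Set Implicit Arguments.
Unset Strict Implicit.
Unset Printing Implicit Defensive.

Import Order.TTheory GRing.Theory Num.Theory.
Import numFieldNormedType.Exports.

Local Open Scope classical_set_scope.
Local Open Scope ring_scope.

(** Write A = a 0, t_k = t.A^(-k) for the backward orbit of t, which tends to 0,
and Q_C for the set of elements of F' fixing c_k for all c in C and all k >= 0.
When C has a positive element and an upper bound s < r 0, Q_C is a strictly
confining subgroup: elements of F' are trivial near 0, and on [0, r 0] an element
z of Z^n acts as the power of A of exponent chi(z). All classes in the theorem
come from such fixers.

For a confining Q let its level k consist of the h in F' with h^(A^k) in Q. The
levels exhaust F', a product of two elements of level k has level k + c, so a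
product of 2^L of them has level k + c L, and conjugation by A lowers levels by
one. A confining Q1 precedes Q2 exactly when Q2 lies in one level of Q1
(conf_le_level): the letters of a word from Z_chi can be collected at its end, and
what is collected is in F' and commutes with Z^n, hence lies in Q1. In
particular the class of Q is in LL_t if and only if it dominates that of Q_{t}
(LL_iff), so LL_t is the upper set of this class.

Largest element (pull_fixer_largest): take C = ]-oo, t]. For elements g supported
in [t, 1], conjugation by A^N agrees with conjugation by one element f of F' that
coincides with A^N on [t, 1]. The first lowers the level of g by N, the second
changes it by at most 2c once it exceeds the level of f, so for N > 2c the levels
of such g are bounded.

Minimality (pull_fixer_minimal): let Q be confining with Q preceding Q_{t}, and
suppose that Q does not fix a tail of the orbit of t. Then for each i it contains
an element moving t_i and fixing t_j for all j > i. With these and the elements of F'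
fixing t_j for j >= M, one can write every element fixing t_j for j >= M + K as a
word of length O(K) (tail_fixer_word). Such a word lies only O(log K) levels up,
whereas passing from M to M + K shifts levels by exactly K; so the level does not
grow with M at all, and Q is the whole of F', thus not strictly confining.

Separation (pull_fixer_separate): if x in [t0, t0.A[ stays away from C, which lies
in a compact part of that fundamental domain, then an element of F' supported
near x_k fixes all c_j and moves x_k, for any k; hence the class of Q_C does not
dominate that of Q_{x}. This distinguishes the LL_t. Adjoining to {t}, {t'} or
{t, t'} the subsets of a strictly increasing sequence in the domain
yields the copies of the power set of N.

Elements of F' are produced by two devices: one explicit piecewise linear
homeomorphism with given support (hill), and a commutator trick (derived_cut)
that truncates an element and lands in F'. *)

(** * Subgroups generated by a set *)

Section Generation.
Local Open Scope group_scope.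
Context {G : groupType}.
Implicit Types (S N : set G) (g h : G).

(** Subgroups as classical sets, the form in which generated subgroups come. *)
Record subgroup_like N : Prop := SubgroupLike {
  sgl1 : N 1; sglM : forall g h, N g -> N h -> N (g * h);
  sglV : forall g, N g -> N g^-1 }.

Lemma word_ball1 S k : word_ball S k 1.
Proof. by exists [::]; split => //; rewrite big_nil. Qed.

Lemma word_ball_gen S k g : (0 < k)%N -> S g -> word_ball S k g.
Proof.
move=> k0 Sg; exists [:: g]; split=> //; last by rewrite big_seq1.
by move=> s; rewrite inE => /eqP ->; left.
Qed.

Lemma word_ball_split S k g : word_ball S k.+1 g ->
  g = 1 \/ exists s h, [/\ S s \/ S s^-1, word_ball S k h & g = (s * h)].
Proof.
move=> [[|s w] [sw wS ->]]; first by left; rewrite big_nil.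
right; exists s, (\prod_(i <- w) i); rewrite big_cons; split=> //.
  by apply: wS; rewrite mem_head.
by exists w; split=> // t tw; apply: wS; rewrite in_cons tw orbT.
Qed.

Lemma generated_subgroup S : subgroup_like (generated S).
Proof.
split; first by exists 0%N => //; exact: word_ball1.
- by move=> g h [k _ gk] [m _ hm]; exists (k + m)%N => //; exact: word_ball_mul.
- by move=> g [k _ gk]; exists k => //; exact: word_ball_inv.
Qed.

Lemma sub_generated S : S `<=` generated S.
Proof. by move=> g Sg; exists 1%N => //; exact: word_ball_gen. Qed.

Lemma generated_min S N : subgroup_like N -> S `<=` N -> generated S `<=` N.
Proof.
move=> [N1 NM NV] SN g [k _ [w [_ wS ->]]].
elim: w wS => [|s w IH] wS; first by rewrite big_nil.
rewrite big_cons; apply: NM.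
  by case: (wS s); rewrite ?mem_head // => /SN // /NV; rewrite invgK.
by apply: IH => x xw; apply: wS; rewrite in_cons xw orbT.
Qed.

Lemma derived_subgroupP : subgroup_like (@derived_subgroup G).
Proof. exact: generated_subgroup. Qed.

Lemma derived_commg g h : (@derived_subgroup G) [~ g, h].
Proof. by apply: sub_generated; exists g, h. Qed.

Lemma derived_conjg g h : (@derived_subgroup G) g -> (@derived_subgroup G) (g ^ h).
Proof.
move=> Dg; have -> : g ^ h = g * [~ g, h] by rewrite commgEl mulVKg.
by apply: (sglM derived_subgroupP) => //; exact: derived_commg.
Qed.

Lemma centralizer_subgroup g : subgroup_like [set h | commute h g].
Proof.
split=> /=; first exact/commute_sym/commute1.
- by move=> h k /commute_sym gh /commute_sym gk; apply/commute_sym/commuteM.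
- by move=> h /commute_sym gh; apply/commute_sym/commuteV.
Qed.

Lemma generated_commute S :
  (forall g h, S g -> S h -> commute g h) ->
  forall g h, generated S g -> generated S h -> commute g h.
Proof.
move=> Scomm g h Sg Sh.
apply: (generated_min (centralizer_subgroup h) _ Sg) => {g Sg} g Sg /=.
apply/commute_sym.
by apply: (generated_min (centralizer_subgroup g) _ Sh) => {h Sh} h Sh /=; exact: Scomm.
Qed.

End Generation.

(** * Piecewise linear elements with prescribed support *)

Section Hill.
Context {R : realType} (n : nat) (hn : (2 <= n)%N).
Variables (p q d : R).
Let N : R := n%:R.
Hypotheses (d0 : 0 < d) (pq : p + (N + 1) * d <= q).

Let N2 : 2 <= N. Proof. by rewrite /N (ler_nat R 2). Qed.
Let N0 : 0 < N. Proof. by move: N2; lra. Qed.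

(** The graph of hill lies above the diagonal exactly over ]p, q[, with slopes
   n, 1 and n^-1; its four breakpoints stay in Z[1/n] because the middle part of
   slope one absorbs the length that a choice of d leaves over. Writing the
   displacement with minima and maxima makes continuity immediate. *)
Definition hill_height (x : R) := Num.max 0 (Num.min (x - p) (Num.min d ((q - x) / N))).
Definition hill (x : R) := x + (N - 1) * hill_height x.
Definition hill_drop (x : R) := Num.max 0 (Num.min ((x - p) / N) (Num.min d (q - x))).
Definition hill_inv (x : R) := x - (N - 1) * hill_drop x.

Let divle (u v : R) : (u / N <= v) = (u <= N * v).
Proof. by rewrite ler_pdivrMr // mulrC. Qed.
Let ledivr (u v : R) : (v <= u / N) = (N * v <= u).
Proof. by rewrite ler_pdivlMr // mulrC. Qed.

Lemma hill_height_out x : x <= p \/ q <= x -> hill_height x = 0.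
Proof.
move=> h; apply/max_idPl; rewrite !ge_min.
case: h => h; first by rewrite !subr_le0 h ?orbT.
by rewrite divle mulr0 !subr_le0 h !orbT.
Qed.

Lemma hill_height_up x : p <= x <= p + d -> hill_height x = x - p.
Proof.
move=> /andP[px xd]; rewrite /hill_height (min_idPl _) ?(max_idPr _) ?subr_ge0 //.
rewrite le_min ledivr; apply/andP; split; first lra.
have : N * (x - p) <= N * d by rewrite ler_pM2l //; lra.
move: pq; rewrite mulrDl mul1r; lra.
Qed.

Lemma hill_height_mid x : p + d <= x <= q - N * d -> hill_height x = d.
Proof.
move=> /andP[px xd]; rewrite /hill_height (min_idPr _); last first.
  by rewrite ge_min; apply/orP; left; lra.
rewrite (min_idPl _) ?(max_idPr (ltW d0)) // ledivr; lra.
Qed.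

Lemma hill_height_down x : q - N * d <= x <= q -> hill_height x = (q - x) / N.
Proof.
move=> /andP[px xd]; rewrite /hill_height.
have le_d : (q - x) / N <= d by rewrite divle; lra.
rewrite (min_idPr _); last first.
  rewrite ge_min; apply/orP; right.
  by apply: (le_trans le_d); move: pq; rewrite mulrDl mul1r; lra.
by rewrite (min_idPr _) ?(max_idPr _) // divr_ge0 ?subr_ge0 // ltW.
Qed.

Lemma hill_drop_out x : x <= p \/ q <= x -> hill_drop x = 0.
Proof.
move=> h; apply/max_idPl; rewrite !ge_min.
case: h => h; first by rewrite divle mulr0 !subr_le0 h ?orbT.
by rewrite !subr_le0 h !orbT.
Qed.

Lemma hill_drop_up x : p <= x <= p + N * d -> hill_drop x = (x - p) / N.
Proof.
move=> /andP[px xd]; rewrite /hill_drop.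
have le_d : (x - p) / N <= d by rewrite divle; lra.
rewrite (min_idPl _) ?(max_idPr _) ?divr_ge0 ?subr_ge0 ?(ltW N0) //.
by rewrite le_min le_d (le_trans le_d) //; move: pq; rewrite mulrDl mul1r; lra.
Qed.

Lemma hill_drop_mid x : p + N * d <= x <= q - d -> hill_drop x = d.
Proof.
move=> /andP[px xd]; rewrite /hill_drop (min_idPr _); last first.
  by rewrite ge_min ledivr; apply/orP; left; rewrite lerBrDl.
by rewrite (min_idPl _) ?(max_idPr (ltW d0)) //; lra.
Qed.

Lemma hill_drop_down x : q - d <= x <= q -> hill_drop x = q - x.
Proof.
move=> /andP[px xd]; rewrite /hill_drop (min_idPr _); last first.
  rewrite ge_min ledivr; apply/orP; left.
  by move: pq; rewrite mulrDl mul1r; lra.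
by rewrite (min_idPr _) ?(max_idPr _); lra.
Qed.

Let divN x : x / N * N = x. Proof. by rewrite divfK // gt_eqF. Qed.

Lemma hillK : cancel hill hill_inv.
Proof.
move=> x; rewrite /hill.
have pq' : p + N * d + d <= q by move: pq; rewrite mulrDl mul1r addrA.
have [xp|px] := leP x p.
  by rewrite hill_height_out ?mulr0 ?addr0 /hill_inv ?hill_drop_out ?mulr0 ?subr0 //; left.
have [xd|dx] := leP x (p + d).
  rewrite hill_height_up ?xd ?ltW // /hill_inv.
  have e1 : N * (x - p) <= N * d by rewrite ler_pM2l //; lra.
  have e2 : 0 <= N * (x - p) by rewrite mulr_ge0 ?ltW // subr_gt0.
  rewrite hill_drop_up.
    have -> : (x + (N - 1) * (x - p) - p) = (x - p) * N by ring.
    by rewrite mulfK ?gt_eqF //; ring.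
  apply/andP; split; lra.
have [xd'|dx'] := leP x (q - N * d).
  rewrite hill_height_mid ?xd' ?ltW // /hill_inv hill_drop_mid; first by ring.
  by apply/andP; split; lra.
have [xq|qx] := leP x q; last first.
  by rewrite hill_height_out ?mulr0 ?addr0 /hill_inv ?hill_drop_out ?mulr0 ?subr0 //;
     right; apply/ltW.
rewrite hill_height_down ?xq ?ltW // /hill_inv.
have e := divN (q - x); set y := (q - x) / N in e *.
have e0 : 0 <= y by rewrite divr_ge0 ?subr_ge0 ?(ltW N0).
have e1 : y <= d by rewrite /y divle; lra.
rewrite hill_drop_down.
  by have -> : q - (x + (N - 1) * y) = y; [lra|ring].
by apply/andP; split; lra.
Qed.

Lemma hill_invK : cancel hill_inv hill.
Proof.
move=> x; rewrite /hill_inv.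
have pq' : p + N * d + d <= q by move: pq; rewrite mulrDl mul1r addrA.
have [xp|px] := leP x p.
  by rewrite hill_drop_out ?mulr0 ?subr0 /hill ?hill_height_out ?mulr0 ?addr0 //; left.
have [xd|dx] := leP x (p + N * d).
  rewrite hill_drop_up ?xd ?ltW // /hill.
  have e := divN (x - p); set y := (x - p) / N in e *.
  have e0 : 0 <= y by rewrite divr_ge0 ?subr_ge0 ?(ltW N0) ?(ltW px).
  have e1 : y <= d by rewrite /y divle; lra.
  rewrite hill_height_up.
    by have -> : x - (N - 1) * y - p = y; [lra|ring].
  by apply/andP; split; lra.
have [xd'|dx'] := leP x (q - d).
  rewrite hill_drop_mid ?xd' ?ltW // /hill hill_height_mid; first by ring.
  by apply/andP; split; lra.
have [xq|qx] := leP x q; last first.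
  by rewrite hill_drop_out ?mulr0 ?subr0 /hill ?hill_height_out ?mulr0 ?addr0 //;
     right; apply/ltW.
rewrite hill_drop_down ?xq ?ltW // /hill.
have e1 : N * (q - x) <= N * d by rewrite ler_pM2l //; lra.
have e2 : 0 <= N * (q - x) by rewrite mulr_ge0 ?(ltW N0) ?subr_ge0.
rewrite hill_height_down.
  have -> : (q - (x - (N - 1) * (q - x))) = (q - x) * N by ring.
  by rewrite mulfK ?gt_eqF //; ring.
by apply/andP; split; lra.
Qed.

Let continuous_clamp (f g : R -> R) : continuous f -> continuous g ->
  continuous (fun x => Num.max 0 (Num.min (f x) (Num.min d (g x)))).
Proof.
move=> fc gc x.
apply: (@continuous_max R R (cst 0) (f \min (cst d \min g))); first exact: cvg_cst.
apply: (@continuous_min R R f (cst d \min g)); first exact: fc.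
by apply: (@continuous_min R R (cst d) g); [exact: cvg_cst|exact: gc].
Qed.

Lemma continuous_hill : continuous hill.
Proof.
move=> x; apply: cvgD; first exact: cvg_id.
apply: cvgM; first exact: cvg_cst.
apply: (@continuous_clamp (fun x => x - p) (fun x => (q - x) / N)) => y.
  by apply: cvgB; [exact: cvg_id|exact: cvg_cst].
by apply: cvgM; [apply: cvgB; [exact: cvg_cst|exact: cvg_id]|exact: cvg_cst].
Qed.

Lemma continuous_hill_inv : continuous hill_inv.
Proof.
move=> x; apply: cvgB; first exact: cvg_id.
apply: cvgM; first exact: cvg_cst.
apply: (@continuous_clamp (fun x => (x - p) / N) (fun x => q - x)) => y.
  by apply: cvgM; [apply: cvgB; [exact: cvg_id|exact: cvg_cst]|exact: cvg_cst].
by apply: cvgB; [exact: cvg_cst|exact: cvg_id].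
Qed.

Let pq' : p + d + N * d <= q.
Proof. by move: pq; rewrite mulrDl mul1r; lra. Qed.

(** The height drops with slope at least - 1/n, which the factor n - 1 cannot
   turn into a descent of the hill. *)
Lemma hill_homo : {homo hill : x y / x < y}.
Proof.
move=> x y xy; rewrite /hill -/N.
pose s := (y - x) / N.
have sN : s * N = y - x by rewrite divfK // gt_eqF.
have s0 : 0 < s by rewrite divr_gt0 ?subr_gt0.
have sNs : 2 * s <= N * s by rewrite ler_wpM2r // ltW.
suff hxy : hill_height x <= hill_height y + s.
  have : (N - 1) * hill_height x <= (N - 1) * (hill_height y + s).
    by rewrite ler_pM2l //; move: N2; lra.
  rewrite mulrDr [(N - 1) * s]mulrBl mul1r [N * s]mulrC sN. lra.
have yqE : (q - y) / N = (q - x) / N - s by rewrite /s -mulrBl; congr (_ / _); ring.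
rewrite /hill_height -/N yqE; move: ((q - x) / N) => c.
rewrite ge_max addr_ge0 ?(ltW s0) ?le_max ?lexx //=.
rewrite -lerBlDr le_max; apply/orP; right.
by rewrite !le_min !lerBlDr !ge_min subrK; apply/and3P; split;
  apply/or3P; [apply: Or31|apply: Or32|apply: Or33]; lra.
Qed.

Lemma hill_PL : Zinv n p -> Zinv n q -> Zinv n d -> PL n hill.
Proof.
move=> pZ qZ dZ; have NZ : Zinv n N by have := @Zinv_exp R n 1; rewrite expr1z.
exists [:: p; p + d; q - N * d; q].
  move=> b; rewrite !inE => /or4P[] /eqP -> //; first exact: ZinvD.
  by apply: ZinvD => //; apply: ZinvN; exact: ZinvM.
move=> u v _ uv _ avoid.
have side b : b \in [:: p; p + d; q - N * d; q] -> b <= u \/ v <= b.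
  by move=> /avoid; rewrite in_itv /= negb_and -!leNgt => /orP.
rewrite /affine_between /hill -/N.
case: (side p) => [|pu|vp]; first by rewrite !inE eqxx.
  case: (side (p + d)) => [|pdu|vpd]; first by rewrite !inE eqxx orbT.
    case: (side (q - N * d)) => [|qdu|vqd]; first by rewrite !inE eqxx !orbT.
      case: (side q) => [|qu|vq]; first by rewrite !inE eqxx !orbT.
        exists 0 => x y; rewrite !in_itv /= => /andP[ux xv] /andP[uy yv].
        by rewrite expr0z !hill_height_out ?mulr0 ?addr0 ?mul1r //; right;
          [exact: le_trans ux|exact: le_trans uy].
      exists (-1) => x y; rewrite !in_itv /= => /andP[ux xv] /andP[uy yv].
      rewrite exprN1 !hill_height_down ?(le_trans qdu) ?(le_trans _ vq) // -/N.
      by field; rewrite gt_eqF.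
    exists 0 => x y; rewrite !in_itv /= => /andP[ux xv] /andP[uy yv].
    by rewrite expr0z !hill_height_mid ?(le_trans pdu) ?(le_trans _ vqd) //; lra.
  exists 1 => x y; rewrite !in_itv /= => /andP[ux xv] /andP[uy yv].
  rewrite expr1z !hill_height_up ?(le_trans pu) ?(le_trans _ vpd) // -/N; ring.
exists 0 => x y; rewrite !in_itv /= => /andP[ux xv] /andP[uy yv].
by rewrite expr0z !hill_height_out ?mulr0 ?addr0 ?mul1r //; left; exact: le_trans vp.
Qed.

Lemma hill_in_F : Zinv n p -> Zinv n q -> Zinv n d -> 0 <= p -> q <= 1 ->
  in_F n hill.
Proof.
move=> pZ qZ dZ p0 q1; split; last exact: hill_PL.
- exists (hill_inv); split.
  + exact: hillK.
  + exact: hill_invK.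
  + exact: continuous_hill.
  + exact: continuous_hill_inv.
- exact: hill_homo.
- move=> x; rewrite in_itv /= negb_and -!leNgt => x01.
  rewrite /hill hill_height_out // ?mulr0 ?addr0 //.
  by case/orP: x01 => x01; [left; exact: le_trans p0|right; exact: le_trans x01].
Qed.

Lemma hill_gt x : p < x < q -> x < hill x.
Proof.
move=> /andP[px xq]; rewrite /hill ltrDl mulr_gt0 //; first by move: N2; lra.
rewrite /hill_height lt_max !lt_min subr_gt0 px d0 divr_gt0 ?subr_gt0 //.
by rewrite orbT.
Qed.

End Hill.

(** * Dynamics of elements of F *)

Section FElements.
Context {R : realType} {n : nat}.
Implicit Types (g h : F R n) (x y : R).

Lemma Fle g : {mono g : x y / x <= y}. Proof. exact: in_F_le (FP g). Qed.
Lemma Flt g : {mono g : x y / x < y}. Proof. exact: in_F_lt (FP g). Qed.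
Lemma FK g x : (g^-1)%g (g x) = x. Proof. exact: (F_invK g).2. Qed.
Lemma FVK g x : g ((g^-1)%g x) = x. Proof. exact: (F_invK g).1. Qed.
Lemma F_injective g : injective g. Proof. exact: can_inj (FK g). Qed.
Lemma F0 g : g 0 = 0. Proof. by rewrite (in_F_fix (FP g)). Qed.
Lemma F1 g : g 1 = 1. Proof. by rewrite (in_F_fix (FP g)). Qed.
Lemma F_gt0 g x : (0 < g x) = (0 < x). Proof. by rewrite -{1}(F0 g) Flt. Qed.
Lemma F_lt1 g x : (g x < 1) = (x < 1). Proof. by rewrite -{1}(F1 g) Flt. Qed.
Lemma F_ge0 g x : (0 <= g x) = (0 <= x). Proof. by rewrite -{1}(F0 g) Fle. Qed.
Lemma F_le1 g x : (g x <= 1) = (x <= 1). Proof. by rewrite -{1}(F1 g) Fle. Qed.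
Lemma F_out g x : x <= 0 \/ 1 <= x -> g x = x.
Proof.
have [_ _ gid _] := FP g => x01; apply: gid.
by rewrite in_itv /= negb_and -!leNgt; case: x01 => ->; rewrite ?orbT.
Qed.

Lemma fixV g x : g x = x -> (g^-1)%g x = x.
Proof. by move=> gx; rewrite -{1}gx FK. Qed.

Lemma F_conjE h g x : (h ^ g)%g x = g (h ((g^-1)%g x)).
Proof. by []. Qed.

Lemma fixJ h g x : (h ^ g)%g x = x <-> h ((g^-1)%g x) = (g^-1)%g x.
Proof.
rewrite F_conjE; split=> [e|->]; last by rewrite FVK.
by rewrite -{2}e FK.
Qed.

Lemma F_expS g k x : (g ^+ k.+1)%g x = g ((g ^+ k)%g x).
Proof. by rewrite expgSr. Qed.

Lemma fixX g k x : g x = x -> (g ^+ k)%g x = x.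
Proof. by move=> gx; elim: k => // k IH; rewrite F_expS IH. Qed.

(** Without a fixed point in ]p, q[ the orbit of x cannot stay below w < q: its
   supremum would be such a fixed point. *)
Lemma orbit_escape g p q x w : (forall y, p < y < q -> y < g y) ->
  p < x -> w < q -> exists k, w <= (g ^+ k)%g x.
Proof.
move=> gP px wq; apply: contrapT => noesc.
have below k : (g ^+ k)%g x < w by rewrite ltNge; apply/negP => ?; apply: noesc; exists k.
pose E := [set (g ^+ k)%g x | k in [set: nat]].
have supE : has_sup E.
  by split; [exists x, 0%N|exists w => _ [k _ <-]; exact: ltW].
have Ele k : (g ^+ k)%g x <= sup E by apply: ub_le_sup; [case: supE|exists k].
have xs : x <= sup E by exact: (Ele 0%N).
have sw : sup E <= w by apply: ge_sup; [case: supE|move=> _ [k _ <-]; exact: ltW].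
have s_up : sup E < g (sup E) by apply: gP; rewrite (lt_le_trans px) ?(le_lt_trans sw).
have s_dn : 0 < sup E - (g^-1)%g (sup E) by rewrite subr_gt0 -(Flt g) FVK.
have [_ [k _ <-]] := sup_adherent s_dn supE.
rewrite subKr -(Flt g) FVK => /lt_le_trans; move: (Ele k.+1).
by rewrite F_expS => sk /(_ _ sk); rewrite ltxx.
Qed.

Lemma Zinv_dense (u v : R) : (2 <= n)%N -> u < v -> exists2 z, Zinv n z & u < z < v.
Proof.
move=> hn uv.
have uv0 : 0 < v - u by rewrite subr_gt0.
pose k := (Num.truncn ((v - u)^-1)).+1.
have kP : (v - u)^-1 < n%:R ^+ k.
  apply: (@lt_trans _ _ k%:R); last by rewrite -natrX ltr_nat ltn_expl.
  by apply: truncnS_gt.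
have nk0 : 0 < n%:R ^+ k :> R by apply: lt_trans kP; rewrite invr_gt0.
exists ((Num.floor (u * n%:R ^+ k) + 1)%:~R / n%:R ^+ k).
  by exists k; rewrite divfK ?gt_eqF // intr_int.
rewrite ltr_pdivlMr // ltr_pdivrMr // floorD1_gt intrD /=.
have := floor_le (u * n%:R ^+ k).
move: kP; rewrite -[X in X < _]mul1r ltr_pdivrMr // mulrBr; lra.
Qed.

Hypothesis hn : (2 <= n)%N.

Lemma hill_element (p q : R) : Zinv n p -> Zinv n q -> 0 <= p -> p < q -> q <= 1 ->
  exists g, (forall x, x <= p \/ q <= x -> g x = x) /\ (forall x, p < x < q -> x < g x).
Proof.
move=> pZ qZ p0 pq q1.
have N0 : 0 < n%:R + 1 :> R by rewrite ltr_wpDl.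
have [|d dZ /andP[d0 dpq]] := @Zinv_dense 0 ((q - p) / (n%:R + 1)) hn.
  by rewrite divr_gt0 ?subr_gt0.
have pqd : p + (n%:R + 1) * d <= q.
  by move: dpq; rewrite ltr_pdivlMr // mulrC; lra.
exists (MkF (hill_in_F hn d0 pqd pZ qZ dZ p0 q1)); split=> /= x.
  by move=> xpq; rewrite /hill hill_height_out // mulr0 addr0.
exact: hill_gt.
Qed.

(** A power of one hill suffices, since its orbits climb to the right end of its
   support. *)
Lemma push_F (al z w de : R) : 0 <= al -> de <= 1 -> al < z < de -> al < w < de ->
  exists g, (forall x, x <= al \/ de <= x -> g x = x) /\ w <= g z.
Proof.
move=> al0 de1 /andP[alz zde] /andP[alw wde].
have [p pZ /andP[alp]] : exists2 p, Zinv n p & al < p < Num.min z w.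
  by apply: Zinv_dense => //; rewrite lt_min alz.
rewrite lt_min => /andP[pz pw].
have [q qZ] : exists2 q, Zinv n q & Num.max z w < q < de.
  by apply: Zinv_dense => //; rewrite gt_max zde.
rewrite gt_max -andbA => /and3P[zq wq qde].
have [| | |g [gid gup]] := hill_element pZ qZ.
- exact: le_trans (ltW alp).
- exact: lt_trans zq.
- exact: le_trans (ltW qde) de1.
have [k kP] := orbit_escape gup pz wq.
exists (g ^+ k)%g; split=> // x xo; apply: fixX; apply: gid.
by case: xo => xo; [left; exact: le_trans (ltW alp)|right; apply: le_trans xo; exact: ltW].
Qed.

End FElements.

(** * Germs at the endpoints and the derived subgroup *)

Section Germs.
Context {R : realType} {n : nat} (hn : (2 <= n)%N).
Implicit Types (g h : F R n) (x y : R).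

Let N0 : 0 < n%:R :> R. Proof. by rewrite ltr0n; case: n hn. Qed.

Definition slope0 g (k : int) :=
  exists2 u : R, 0 < u & forall x, 0 <= x <= u -> g x = n%:R ^ k * x.
Definition slope1 g (k : int) :=
  exists2 u : R, u < 1 & forall x, u <= x <= 1 -> 1 - g x = n%:R ^ k * (1 - x).

Lemma next_point (B : seq R) :
  exists2 u : R, 0 < u <= 1 & forall c, c \in B -> c \notin `]0, u[.
Proof.
elim: B => [|c B [u /andP[u0 u1] uP]]; first by exists 1; rewrite ?ltr01 ?lexx.
have [c0|c0] := leP c 0.
  exists u; rewrite ?u0 // => b; rewrite inE => /orP[/eqP ->|/uP //].
  by rewrite in_itv /= ltNge c0.
exists (Num.min u c); first by rewrite lt_min u0 c0 ge_min u1.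
move=> b; rewrite inE => /orP[/eqP ->|/uP].
  by rewrite in_itv /= lt_min ltxx !andbF.
by apply: contra; rewrite !in_itv /= lt_min => /and3P[-> ->].
Qed.

Lemma slope0_ex g : exists k, slope0 g k.
Proof.
have [_ _ _ [B _ BP]] := FP g.
have [u /andP[u0 u1] uP] := next_point B.
have [k kP] := BP 0 u (lexx 0) u0 u1 uP.
exists k, u => // x xu; have := kP 0 x; rewrite F0 !subr0; apply => //.
by rewrite in_itv /= lexx ltW.
Qed.

Lemma slope1_ex g : exists k, slope1 g k.
Proof.
have [_ _ _ [B _ BP]] := FP g.
have [b [_ b0 b1 bP]] := prev_point B (@ltr01 R).
have [k kP] := BP b 1 b0 b1 (lexx 1) bP.
exists k, b => // x xb; have := kP x 1; rewrite F1; apply => //.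
by rewrite in_itv /= lexx ltW.
Qed.


Lemma slope0M g h k m : slope0 g k -> slope0 h m -> slope0 (g * h)%g (k + m).
Proof.
move=> [u u0 gu] [v v0 hv]; exists (Num.min u ((g^-1)%g v)).
  by rewrite lt_min u0 F_gt0.
move=> x /andP[x0]; rewrite le_min => /andP[xu xv].
rewrite F_mulE hv; last by rewrite F_ge0 x0 -[v](FVK g) Fle.
by rewrite gu ?x0 // mulrA -expfzDr ?gt_eqF // addrC.
Qed.

Lemma slope1M g h k m : slope1 g k -> slope1 h m -> slope1 (g * h)%g (k + m).
Proof.
move=> [u u0 gu] [v v0 hv]; exists (Num.max u ((g^-1)%g v)).
  by rewrite gt_max u0 F_lt1.
move=> x /andP[]; rewrite ge_max => /andP[xu xv x1].
rewrite F_mulE hv; last by rewrite F_le1 x1 -[v](FVK g) Fle xv.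
by rewrite gu ?x1 ?xu // mulrA -expfzDr ?gt_eqF // addrC.
Qed.

Definition trivial0 : set (F R n) :=
  [set g | exists2 u : R, 0 < u & forall x, x <= u -> g x = x].
Definition trivial1 : set (F R n) :=
  [set g | exists2 u : R, u < 1 & forall x, u <= x -> g x = x].

Lemma trivial0_subgroup : subgroup_like trivial0.
Proof.
split; first by exists 1.
- move=> g h [u u0 gu] [v v0 hv]; exists (Num.min u v); first by rewrite lt_min u0.
  by move=> x; rewrite le_min => /andP[xu xv]; rewrite F_mulE gu // hv.
- by move=> g [u u0 gu]; exists u => // x xu; rewrite fixV // gu.
Qed.

Lemma trivial1_subgroup : subgroup_like trivial1.
Proof.
split; first by exists 0.
- move=> g h [u u0 gu] [v v0 hv]; exists (Num.max u v); first by rewrite gt_max u0.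
  by move=> x; rewrite ge_max => /andP[xu xv]; rewrite F_mulE gu // hv.
- by move=> g [u u0 gu]; exists u => // x xu; rewrite fixV // gu.
Qed.

Let commgE g h : [~ g, h]%g = ((h * g)^-1 * (g * h))%g.
Proof. by rewrite [(g * h)%g]commgC mulKg. Qed.

(** Slopes at an endpoint multiply under composition, so commutators have slope
   one there. *)
Lemma derived_trivial0 : @derived_subgroup (F R n) `<=` trivial0.
Proof.
apply: generated_min trivial0_subgroup _ => _ [g [h ->]].
have [k gk] := slope0_ex g; have [m hm] := slope0_ex h.
have [u u0 uP] := slope0M gk hm; have [v v0 vP] := slope0M hm gk.
pose w := Num.min u v; have w0 : 0 < w by rewrite lt_min u0.
exists ((h * g)%g w); first by rewrite F_gt0.
move=> y yw; have [y0|y0] := leP y 0; first by apply: F_out; left.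
rewrite commgE F_mulE; set x := ((h * g)^-1)%g y.
have xE : (h * g)%g x = y by rewrite /x FVK.
have x0 : 0 <= x by rewrite -(F_ge0 (h * g)%g) xE ltW.
have : x <= w by rewrite -(Fle (h * g)%g) xE.
rewrite le_min => /andP[xu xv].
by rewrite -[RHS]xE uP ?x0 // vP ?x0 // addrC.
Qed.

Lemma derived_trivial1 : @derived_subgroup (F R n) `<=` trivial1.
Proof.
apply: generated_min trivial1_subgroup _ => _ [g [h ->]].
have [k gk] := slope1_ex g; have [m hm] := slope1_ex h.
have [u u0 uP] := slope1M gk hm; have [v v0 vP] := slope1M hm gk.
pose w := Num.max u v; have w0 : w < 1 by rewrite gt_max u0.
exists ((h * g)%g w); first by rewrite F_lt1.
move=> y yw; have [y0|y0] := leP 1 y; first by apply: F_out; right.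
rewrite commgE F_mulE; set x := ((h * g)^-1)%g y.
have xE : (h * g)%g x = y by rewrite /x FVK.
have x0 : x <= 1 by rewrite -(F_le1 (h * g)%g) xE ltW.
have : w <= x by rewrite -(Fle (h * g)%g) xE.
rewrite ge_max => /andP[xu xv].
have e1 := uP x; have e2 := vP x; rewrite xu xv x0 in e1 e2.
by apply: (@subrI _ 1); rewrite -[in RHS]xE e1 // e2 // addrC.
Qed.

Lemma slope0_chi0 g k : slope0 g k -> chi0 g = k%:~R.
Proof.
move=> [u u0 gu]; rewrite /chi0.
have -> : lim ((g (0 + e) - g 0) / e @[e --> 0^'+]) = n%:R ^ k.
  apply: cvg_lim => //; apply: cvg_near_cst; near=> e.
  have e0 : 0 < e by near: e; exact: nbhs_right_gt.
  have eu : e <= u by near: e; exact: nbhs_right_le.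
  by rewrite add0r F0 subr0 gu ?(ltW e0) // mulfK // gt_eqF.
have lnN : ln n%:R != 0 :> R by rewrite gt_eqF // ln_gt0 // ltr1n.
have lnX m : ln (n%:R ^+ m) / ln n%:R = m%:R :> R.
  by rewrite lnXn // -[X in X / _]mulr_natl mulfK.
case: k gu => k gu; first exact: lnX.
by rewrite NegzE -exprnN lnV ?posrE ?exprn_gt0 // mulNr lnX mulrNz.
Unshelve. all: by end_near. Qed.

Lemma chi0M g h : chi0 (g * h)%g = chi0 g + chi0 h.
Proof.
have [k gk] := slope0_ex g; have [m hm] := slope0_ex h.
by rewrite (slope0_chi0 gk) (slope0_chi0 hm) (slope0_chi0 (slope0M gk hm)) intrD.
Qed.

Lemma chi0_1 : chi0 (1%g : F R n) = 0.
Proof. by apply: (@addrI _ (chi0 (1%g : F R n))); rewrite -chi0M mulg1 addr0. Qed.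

Lemma chi0V g : chi0 (g^-1)%g = - chi0 g.
Proof. by apply/eqP; rewrite -addr_eq0 -chi0M mulVg chi0_1. Qed.

Lemma chi0X g k : chi0 (g ^+ k)%g = chi0 g *+ k.
Proof. by elim: k => [|k IH]; rewrite ?chi0_1 // expgSr chi0M IH mulrSr. Qed.

Lemma chi0_local g h u : 0 < u -> (forall x, 0 <= x <= u -> g x = h x) -> chi0 g = chi0 h.
Proof.
move=> u0 gh; have [k gk] := slope0_ex g; rewrite (slope0_chi0 gk).
apply/esym/slope0_chi0; case: gk => v v0 gv; exists (Num.min u v); first by rewrite lt_min u0.
move=> x /andP[x0]; rewrite le_min => /andP[xu xv].
by rewrite -gh ?x0 // gv // x0.
Qed.

Local Notation D := (@derived_subgroup (F R n)).

(** Truncating h on the left of c and landing in F': p is the commutator of h^-1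
   and e^-1, where e is the identity on the left of y and of h y but carries h c,
   and all that lies to its right, beyond the support of h. *)
Lemma derived_cut h y c : trivial1 h -> 0 <= y -> y < c -> y < h c ->
  exists p, [/\ D p, forall x, x <= y -> p x = x & forall x, c <= x -> p x = h x].
Proof.
move=> [v v1 hv] y0 yc yhc.
have [c1|c1] := ltP c 1; last first.
  exists 1%g; split=> // [|x cx]; first exact: (sgl1 derived_subgroupP).
  by rewrite (F_out h) //; right; exact: le_trans cx.
have [al [yal hyal al1]] : exists al, [/\ y <= al, h y <= al & al < h c].
  by exists (Num.max y (h y)); rewrite !le_max !lexx orbT gt_max yhc Flt yc.
have hc1 : h c < 1 by rewrite F_lt1.
have [w [alw w1 vw]] : exists w, [/\ al < w, w < 1 & v <= w].
  exists (Num.max ((al + 1) / 2) v); rewrite lt_max gt_max le_max lexx orbT v1 andbT.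
  by split=> //; [apply/orP; left|]; lra.
have [| | | |e [eid ew]] := @push_F R n hn al (h c) w 1.
- exact: le_trans yal.
- exact: lexx.
- by rewrite al1.
- by rewrite alw.
exists (h * e * h^-1 * e^-1)%g; split.
- have -> : (h * e * h^-1 * e^-1 = [~ h^-1, e^-1])%g.
    by rewrite /commg /conjg !invgK !mulgA.
  exact: derived_commg.
- move=> x xy; rewrite !F_mulE.
  have -> : e (h x) = h x by apply: eid; left; apply: le_trans hyal; rewrite Fle.
  by rewrite FK fixV //; apply: eid; left; exact: le_trans yal.
- move=> x cx; rewrite !F_mulE.
  have -> : (h^-1)%g (e (h x)) = e (h x); last by rewrite FK.
  apply: fixV; apply: hv.
  by apply: (le_trans vw); apply: (le_trans ew); rewrite !Fle.
Qed.

Lemma push_derived (al z w de : R) : 0 <= al -> de <= 1 -> al < z < de -> al < w < de ->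
  exists p, [/\ D p, forall x, x <= al \/ de <= x -> p x = x & w <= p z].
Proof.
move=> al0 de1 /andP[alz zde] /andP[alw wde].
pose b := (Num.max z w + de) / 2.
have /andP[bz bw] : (z < b) && (w < b).
  by rewrite -gt_max /b; have : Num.max z w < de; [rewrite gt_max zde|lra].
have bde : b < de.
  by rewrite /b; have : Num.max z w < de; [rewrite gt_max zde|lra].
have [| | | |h [hid hw]] := @push_F R n hn al z w b; rewrite ?alz ?alw //.
  exact: le_trans (ltW bde) de1.
have [| |||p [Dp plo phi]] := @derived_cut h al z.
- by exists b; [exact: lt_le_trans de1|move=> x bx; apply: hid; right].
- exact: al0.
- exact: alz.
- exact: lt_le_trans hw.
exists p; split=> //; last by rewrite phi.
move=> x [/plo //|dex]; have bx := le_trans (ltW bde) dex.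
by rewrite phi; [apply: hid; right|exact: le_trans (ltW bz) bx].
Qed.

End Germs.

(** * The action of Z^n near 0 *)

Section StandardElements.
Context {R : realType} {n : nat} (hn : (2 <= n)%N).
Context {a : nat -> F R n} {l r : nat -> R} (ha : standard_elements a l r).
Implicit Types (g h z : F R n) (x y : R).

Local Notation A := (a 0%N).
Local Notation r0 := (r 0%N).
Local Notation D := (@derived_subgroup (F R n)).

Lemma a_fix i x : (i < n)%N -> x <= l i \/ r i <= x -> a i x = x.
Proof.
move=> i_n xo; have [/(_ i i_n) [_ sE] _ _ _ _] := ha.
apply: contrapT => /eqP ax; have : supp (a i) x by [].
by rewrite sE /= in_itv /= => /andP[lx xr]; case: xo; rewrite leNgt ?lx ?xr.
Qed.

Lemma a_move i x : (i < n)%N -> l i < x < r i -> a i x != x.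
Proof.
move=> i_n lxr; have [/(_ i i_n) [_ sE] _ _ _ _] := ha.
by have : supp (a i) x by rewrite sE /= in_itv.
Qed.

Let lr i : (i < n)%N -> l i < r i.
Proof. by move=> i_n; have [/(_ i i_n) []] := ha. Qed.

Let rl i : (0 < i)%N -> (i < n)%N -> r i.-1 < l i.
Proof.
by move=> i0 i_n; have [_ _ _ /(_ i) rlP _] := ha; apply: rlP; lia.
Qed.

Lemma r_le_l i j : (i < j)%N -> (j < n)%N -> r i < l j.
Proof.
elim: j => // j IH; rewrite ltnS leq_eqVlt => /orP[/eqP -> jn|ij jn]; first exact: (@rl j.+1).
have jn' := ltnW jn.
exact: lt_trans (IH ij jn') (lt_trans (lr jn') (rl _ jn)).
Qed.

Lemma r0_gt0 : 0 < r0.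
Proof. by have [_ [<- _] _ _ _] := ha; apply: lr; lia. Qed.

Lemma r0_lt1 : r0 < 1.
Proof.
have n1 : (1 < n)%N by [].
apply: (lt_le_trans (r_le_l (ltn0Sn 0) n1)); rewrite leNgt; apply/negP => l1.
have lr1 := lr n1; have [m1 m2] : l 1%N < (l 1%N + r 1%N) / 2 /\ (l 1%N + r 1%N) / 2 < r 1%N.
  by split; lra.
have := a_move n1 (introT andP (conj m1 m2)); rewrite F_out ?eqxx //.
by right; exact: ltW (lt_trans l1 m1).
Qed.

Lemma A_fix x : r0 <= x -> A x = x.
Proof. by move=> rx; apply: a_fix; [lia|right]. Qed.

(** The slope of a 0 at 0 is n, and a 0 has no fixed point in ]0, r 0[. *)
Lemma A_gt x : 0 < x < r0 -> x < A x.
Proof.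
move=> /andP[x0 xr]; have [l0 chiA] : l 0%N = 0 /\ chi0 A = 1 by case: ha.
have Amove y : 0 < y < r0 -> A y != y.
  by move=> yP; apply: a_move; [lia|rewrite l0].
have [k Ak] := slope0_ex A.
have k1 : k = 1.
  by apply/eqP; rewrite -(eqr_int R) -(slope0_chi0 hn Ak) chiA.
have [u u0 uP] := Ak; rewrite k1 expr1z in uP.
have up y : 0 < y -> y <= u -> y < A y.
  move=> y0 yu; rewrite uP ?yu ?ltW // -[X in X < _]mul1r ltr_pM2r // ltr1n //.
have [/up -> //|ux] := leP x u.
rewrite ltNge; apply/negP => Ax.
have Acont : {within `[u, x], continuous (fun y => A y - y)}.
  apply: continuous_subspaceT => y; apply: cvgB; last exact: cvg_id.
  by have [[f' [_ _ + _]] _ _ _] := FP A; apply.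
have Au := up _ u0 (lexx u).
have [|c cux /eqP] := IVT (v := 0) (ltW ux) Acont.
  by rewrite ge_min le_max; apply/andP; split; apply/orP; [right|left]; lra.
rewrite subr_eq0; apply/negP; apply: Amove.
move: cux; rewrite in_itv /= => /andP[uc cx].
by rewrite (lt_le_trans u0 uc) (le_lt_trans cx xr).
Qed.

(** Contraction towards 0, written with powers of the inverse so that the
   exponents stay natural numbers. *)
Definition pull (k : nat) x : R := (A^-1 ^+ k)%g x.

Lemma pull0 x : pull 0 x = x. Proof. by []. Qed.
Lemma pullD i j x : pull (i + j) x = pull j (pull i x).
Proof. by rewrite /pull expgnDr. Qed.
Lemma pull_lt k : {mono pull k : x y / x < y}. Proof. exact: Flt. Qed.
Lemma pull_le k : {mono pull k : x y / x <= y}. Proof. exact: Fle. Qed.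
Lemma pull_gt0 k x : (0 < pull k x) = (0 < x). Proof. exact: F_gt0. Qed.
Lemma pullE k x : pull k x = ((A ^+ k)^-1)%g x. Proof. by rewrite /pull expVgn. Qed.
Lemma pullK k x : (A ^+ k)%g (pull k x) = x. Proof. by rewrite pullE FVK. Qed.
Lemma pushK k x : pull k ((A ^+ k)%g x) = x. Proof. by rewrite pullE FK. Qed.

Lemma AX_fix k x : r0 <= x -> (A ^+ k)%g x = x.
Proof. by move=> rx; apply: fixX; exact: A_fix. Qed.

Lemma pull_fix k x : r0 <= x -> pull k x = x.
Proof. by move=> rx; rewrite pullE fixV // AX_fix. Qed.

Lemma AX_comm i j x : (A ^+ i)%g ((A ^+ j)%g x) = (A ^+ j)%g ((A ^+ i)%g x).
Proof.
have e : (A ^+ j * A ^+ i = A ^+ i * A ^+ j)%g by rewrite -!expgnDr addnC.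
exact: (congr1 (fun g : F R n => g x) e).
Qed.

Lemma AX_le_r k x : ((A ^+ k)%g x <= r0) = (x <= r0).
Proof. by rewrite -{1}(AX_fix k (lexx r0)) Fle. Qed.

Lemma pull_le_r k x : (pull k x <= r0) = (x <= r0).
Proof. by rewrite -{1}(pull_fix k (lexx r0)) pull_le. Qed.
Lemma pull_lt_r k x : (pull k x < r0) = (x < r0).
Proof. by rewrite -{1}(pull_fix k (lexx r0)) pull_lt. Qed.

Lemma pullS_lt x k : 0 < x < r0 -> pull k.+1 x < pull k x.
Proof.
move=> xr; rewrite -addn1 pullD -(Flt A) -[A (pull 1 _)]/((A ^+ 1)%g _) pullK.
by apply: A_gt; rewrite pull_gt0 pull_lt_r.
Qed.

Lemma pull_ltn x i j : 0 < x < r0 -> (i < j)%N -> pull j x < pull i x.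
Proof.
move=> xr; elim: j => // j IH; rewrite ltnS leq_eqVlt => /orP[/eqP ->|/IH].
  exact: pullS_lt.
exact: lt_trans (pullS_lt _ xr).
Qed.

Lemma pull_leq x i j : 0 < x < r0 -> (i <= j)%N -> pull j x <= pull i x.
Proof.
by move=> xr; rewrite leq_eqVlt => /orP[/eqP -> //|/(pull_ltn xr)/ltW].
Qed.

Lemma pull_small x e : x < r0 -> 0 < e -> exists k, pull k x < e.
Proof.
move=> xr e0.
have [e0' e2] : 0 < e / 2 /\ e / 2 < e by lra.
have [k kP] := orbit_escape A_gt e0' xr.
exists k; apply: le_lt_trans e2.
by rewrite -(pushK k (e / 2)) pull_le.
Qed.

Lemma Zn_subgroup : subgroup_like (Zn a). Proof. exact: generated_subgroup. Qed.

Lemma Zn_AX k : Zn a (A ^+ k)%g.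
Proof.
elim: k => [|k IH]; first exact: (sgl1 Zn_subgroup).
rewrite expgSr; apply: (sglM Zn_subgroup) => //.
by apply: sub_generated; exists 0%N => //=; lia.
Qed.

Lemma chi0_AX k : chi0 (A ^+ k)%g = k%:R.
Proof. by rewrite chi0X //; have [_ [_ ->] _ _ _] := ha. Qed.

Lemma disjoint_commute g h : (forall x, g x = x \/ h x = x) -> commute g h.
Proof.
move=> gh; apply: F_inj => x; rewrite !F_mulE.
have half g' h' : (forall x, g' x = x \/ h' x = x) -> g' x != x -> h' (g' x) = g' (h' x).
  move=> gh' gx; have [gx'|hx] := gh' x; first by rewrite gx' eqxx in gx.
  rewrite hx; have [ggx|//] := gh' (g' x).
  by move: gx; rewrite -[_ == _](inj_eq (@F_injective _ _ g')) ggx eqxx.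
have [gx|gx] := eqVneq (g x) x; last exact: half.
have [hx|hx] := eqVneq (h x) x; first by rewrite !(gx, hx).
by apply/esym; apply: half => // y; case: (gh y); [right|left].
Qed.

Lemma Zn_commute g h : Zn a g -> Zn a h -> commute g h.
Proof.
apply: generated_commute => _ _ [i /= iN <-] [j /= jN <-].
have lt_commute i' j' : (i' < j')%N -> (j' < n)%N -> commute (a i') (a j').
  move=> ij jn; apply: disjoint_commute => x.
  have [xr|rx] := leP (r i') x.
    by left; apply: a_fix; [exact: ltn_trans jn|right].
  by right; apply: a_fix => //; left; apply/ltW/(lt_trans rx)/r_le_l.
have [ij|ji|<-] := ltngtP i j; first exact: lt_commute.
- by apply/commute_sym/lt_commute.
- exact: commute_refl.
Qed.

(** On [0, r 0] only a 0 acts, so z is a power of it there; the exponent may be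
   negative, hence two natural numbers. *)
Lemma Zn_action z : Zn a z -> exists i j, forall x, x <= r0 -> z ((A ^+ i)%g x) = (A ^+ j)%g x.
Proof.
pose N := [set z | exists i j, forall x, x <= r0 -> z ((A ^+ i)%g x) = (A ^+ j)%g x].
suff sub : Zn a `<=` N by move=> /sub.
apply: generated_min => {z}.
  split; first by exists 0%N, 0%N.
  - move=> z z' [i [j ij]] [i' [j' ij']]; exists (i' + i)%N, (j + j')%N => x xr.
    by rewrite F_mulE !expgnDr !F_mulE ij ?AX_le_r // AX_comm ij' ?AX_le_r.
  - move=> z [i [j ij]]; exists j, i => x xr.
    by rewrite -ij // FK.
move=> _ [[|i] /= iN <-]; first by exists 0%N, 1%N => x _; rewrite expg1.
exists 0%N, 0%N => x xr; apply: a_fix => //; left.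
by apply: (le_trans xr); apply/ltW/r_le_l.
Qed.

Lemma Zn_chi0 z i j : (forall x, x <= r0 -> z ((A ^+ i)%g x) = (A ^+ j)%g x) ->
  chi0 z = j%:R - i%:R.
Proof.
move=> ij; rewrite -!chi0_AX -(@chi0_local _ _ hn (A ^+ i * z)%g (A ^+ j)%g r0 r0_gt0).
  by rewrite chi0M // addrAC subrr add0r.
by move=> x /andP[_ xr]; rewrite F_mulE ij.
Qed.

Lemma Zn_nonneg z : Zn a z -> 0 <= chi0 z ->
  exists2 k, chi0 z = k%:R & forall x, x <= r0 -> (z^-1)%g x = pull k x.
Proof.
move=> /Zn_action [i [j ij]]; rewrite (Zn_chi0 ij) subr_ge0 ler_nat => le_ij.
exists (j - i)%N; first by rewrite natrB.
move=> x xr; apply: (@F_injective _ _ z); rewrite FVK.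
rewrite -[pull _ x](pullK i) ij ?pull_le_r // -pullD subnK //.
by rewrite pullK.
Qed.

Lemma chi0_bound z : Zn a z -> exists k : nat, - k%:R <= chi0 z <= k%:R.
Proof.
move=> /Zn_action [i [j ij]]; rewrite (Zn_chi0 ij); exists (i + j)%N.
by rewrite natrD; apply/andP; split; have := ler0n R i; have := ler0n R j; lra.
Qed.

End StandardElements.
Arguments pull {R n} a k x.

(** * Confining sets and their levels *)

Section Confining.
Context {R : realType} {n : nat} (hn : (2 <= n)%N).
Context {a : nat -> F R n} {l r : nat -> R} (ha : standard_elements a l r).
Implicit Types (g h z : F R n) (x y : R) (Q : set (F R n)).

Local Notation A := (a 0%N).
Local Notation D := (@derived_subgroup (F R n)).

(** For a confining Q the levels exhaust F' increasingly. The index behaves like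
   a valuation: products raise it by a bounded amount and conjugation by A lowers
   it by exactly one. *)
Definition level Q k : set (F R n) := [set h | Q (h ^ (A ^+ k))%g].

Lemma levelD Q i j h : level Q (i + j) h = level Q i (h ^ (A ^+ j))%g.
Proof. by rewrite /level /= -conjgM -expgnDr addnC. Qed.

Lemma level0 Q h : level Q 0 h = Q h.
Proof. by rewrite /level /= conjg1. Qed.

Section Levels.
Context {Q} (cQ : confining a Q).

Lemma confining_derived h : Q h -> D h.
Proof. by have [QD _ _ _ _] := cQ; exact: QD. Qed.

Lemma confiningV h : Q h -> Q h^-1%g.
Proof. by have [_ QV _ _ _] := cQ; rewrite {2}QV; exists h. Qed.

Lemma confining_conj z h : Zn a z -> 0 <= chi0 z -> Q h -> Q (h ^ z)%g.
Proof. by move=> Zz z0 Qh; have [_ _ /(_ z Zz z0) QJ _ _] := cQ; apply: QJ; exists h. Qed.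

Lemma level_derived k h : level Q k h -> D h.
Proof.
move=> /confining_derived Dh; rewrite -[h](conjgK (A ^+ k)%g).
exact: derived_conjg.
Qed.

(** When z has character at most k, conjugation by z^-1 A^k preserves Q. *)
Let level_of_conj z k h : Zn a z -> chi0 z <= k%:R -> Q (h ^ z)%g -> level Q k h.
Proof.
move=> Zz zk Qh; rewrite /level /= -[(A ^+ k)%g](mulVKg z) conjgM.
apply: confining_conj => //.
  apply: (sglM Zn_subgroup); first exact: (sglV Zn_subgroup).
  exact: (Zn_AX hn).
by rewrite chi0M // chi0V // (chi0_AX hn ha) addrC subr_ge0.
Qed.

Lemma level_exhaust h : D h -> exists k, level Q k h.
Proof.
have [_ _ _ Qex _] := cQ => /Qex [z Zz Qz].
have [k /andP[_ zk]] := chi0_bound hn ha Zz.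
by exists k; exact: level_of_conj Qz.
Qed.

Lemma level_mul_const : exists c, forall g h, Q g -> Q h -> level Q c (g * h)%g.
Proof.
have [_ _ _ _ [z Zz Qz]] := cQ; have [k /andP[_ zk]] := chi0_bound hn ha Zz.
exists k => g h Qg Qh; apply: level_of_conj zk _ => //.
by apply: Qz; exists (g * h)%g => //; exists g => //; exists h.
Qed.

Lemma level_conj z k h : Zn a z -> -1 <= chi0 z -> level Q k h -> level Q k.+1 (h ^ z)%g.
Proof.
move=> Zz z1; rewrite /level /= -conjgM => Qh.
have -> : (z * A ^+ k.+1 = A ^+ k * (z * A))%g.
  by rewrite expgSr !mulgA (Zn_commute hn ha Zz (Zn_AX hn k)).
rewrite conjgM; apply: confining_conj => //.
  by apply: (sglM Zn_subgroup) => //; exact: (Zn_AX hn 1).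
by rewrite chi0M // -[A]expg1 (chi0_AX hn ha) -lerBlDr sub0r.
Qed.

Lemma level_leq i j h : (i <= j)%N -> level Q i h -> level Q j h.
Proof.
move=> /subnK <-; elim: (j - i)%N => // k IH /IH.
rewrite addSn -[h in _ -> level _ _ h]conjg1; apply: level_conj.
  exact: (sgl1 Zn_subgroup).
by rewrite chi0_1 // oppr_le0.
Qed.

Lemma levelV i h : level Q i h -> level Q i h^-1%g.
Proof. by rewrite /level /= conjVg; exact: confiningV. Qed.

Lemma level_one i : level Q i 1%g.
Proof.
have [k] := level_exhaust (sgl1 derived_subgroupP).
by rewrite /level /= !conj1g.
Qed.

Section Product.
Context {c : nat} (cP : forall g h, Q g -> Q h -> level Q c (g * h)%g).

Lemma levelM i g h : level Q i g -> level Q i h -> level Q (c + i) (g * h)%g.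
Proof. by rewrite levelD conjMg; exact: cP. Qed.

(** Each doubling of the word length costs a single application of levelM. *)
Lemma level_word L i : word_ball (level Q i) (2 ^ L) `<=` level Q (c * L + i).
Proof.
elim: L => [|L IH] _ [w [sw wS ->]].
  rewrite muln0 add0n; case: w sw wS => [|s [|//]] _ wS.
    by rewrite big_nil; exact: level_one.
  rewrite big_seq1; case: (wS s); rewrite ?mem_head // => /levelV.
  by rewrite invgK.
rewrite -[w](cat_take_drop (2 ^ L)) big_cat mulnS -addnA; apply: levelM; apply: IH.
  exists (take (2 ^ L) w); split=> // [|s /mem_take]; last exact: wS.
  by rewrite size_take; case: ltnP.
exists (drop (2 ^ L) w); split=> // [|s /mem_drop]; last exact: wS.
by rewrite size_drop leq_subLR addnn -mul2n -expnS.
Qed.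

End Product.
End Levels.

Lemma confining_build Q : Q `<=` D -> (forall h, Q h -> Q h^-1%g) ->
  (forall z h, Zn a z -> 0 <= chi0 z -> Q h -> Q (h ^ z)%g) ->
  (forall h, D h -> exists k, level Q k h) ->
  (exists c, forall g h, Q g -> Q h -> level Q c (g * h)%g) ->
  confining a Q.
Proof.
move=> QD QV QJ Qex [c cP]; split=> //.
- apply/seteqP; split=> [h Qh|_ [h Qh <-]]; last exact: QV.
  by exists h^-1%g; [exact: QV|rewrite invgK].
- by move=> z Zz z0 _ [h Qh <-]; exact: QJ.
- by move=> h /Qex [k kP]; exists (A ^+ k)%g => //; exact: (Zn_AX hn).
exists (A ^+ c)%g; first exact: (Zn_AX hn).
by move=> _ [_ [g Qg [h Qh <-]] <-]; exact: cP.
Qed.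

(** If conjugation by A maps Q onto itself, every element of F' that some power
   of A pushes into Q was there from the start. *)
Lemma strictly_confiningP Q :
  strictly_confining a Q <-> confining a Q /\ exists2 h, D h & ~ Q h.
Proof.
split=> -[cQ].
  move=> [z Zz [QzQ nQ]]; split=> //; apply: contrapT => noh.
  have QD h : D h -> Q h by move=> Dh; apply: contrapT => Qh; apply: noh; exists h.
  apply: nQ => h Qh; exists (h ^ z^-1)%g; last by rewrite conjgKV.
  by apply: QD; apply: derived_conjg; exact: (confining_derived cQ).
move=> [h Dh Qh]; split=> //; exists A; first exact: (Zn_AX hn 1).
split.
  move=> _ [g Qg <-]; apply: (confining_conj cQ) => //; first exact: (Zn_AX hn 1).
  by rewrite -[A]expg1 (chi0_AX hn ha).
move=> QA; apply: Qh; have [k] := level_exhaust cQ Dh.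
elim: k => [|k IH]; first by rewrite level0.
rewrite /level /= expgSr conjgM => /QA [g Qg /conjg_inj e]; apply: IH.
by rewrite /level /= -e.
Qed.

(** In a word in Q and Zchi the letters from Zchi can be moved to the right,
   conjugating those from Q by elements of bounded character; what remains on the
   right lies in F', hence in Q because conjugation by Z^n fixes it. *)
Lemma conf_le_level Q1 Q2 : confining a Q1 -> confining a Q2 ->
  conf_le a Q1 Q2 <-> exists k, Q2 `<=` level Q1 k.
Proof.
move=> c1 c2; split=> -[k kP]; last first.
  exists (k + 1 + k)%N => h /kP Qh.
  have ZA i : word_ball (Q1 `|` Zchi a) i (A ^+ i)%g.
    elim: i => [|i IH]; first exact: word_ball1.
    rewrite expgSr -addn1; apply: word_ball_mul => //; apply: word_ball_gen => //; right.
    by split; [exact: (Zn_AX hn 1)|rewrite -[A]expg1 (chi0_AX hn ha) normr1].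
  rewrite -[h](conjgK (A ^+ k)%g) conjgE invgK mulgA.
  apply: word_ball_mul; last exact: word_ball_inv.
  by apply: word_ball_mul => //; apply: word_ball_gen => //; left.
have [c cP] := level_mul_const c1.
suff [i iP] : exists i, forall g, word_ball (Q1 `|` Zchi a) k g ->
    exists h z, [/\ g = (h * z)%g, level Q1 i h & Zn a z].
  exists (c + i)%N => g Qg; have [h [z [gE Qh Zz]]] := iP _ (kP _ Qg).
  rewrite gE; apply: (levelM cP) => //.
  have Dz : D z.
    have -> : z = (h^-1 * g)%g by rewrite gE mulKg.
    apply: (sglM derived_subgroupP); last exact: (confining_derived c2).
    exact: (sglV derived_subgroupP (level_derived c1 Qh)).
  have fixz j : (z ^ (A ^+ j))%g = z.
    by rewrite conjgE (Zn_commute hn ha Zz (Zn_AX hn j)) mulKg.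
  have [j] := level_exhaust c1 Dz; by rewrite /level /= !fixz.
elim: k {kP} => [|k [i IH]].
  exists 0%N => g [[|s w] [sw _ ->]] //; exists 1%g, 1%g; rewrite big_nil mulg1; split=> //.
    exact: level_one.
  exact: (sgl1 Zn_subgroup).
exists (c + i.+1)%N => g /word_ball_split [->|[s [g' [sS /IH [h [z [-> Qh Zz]]] ->]]]].
  by exists 1%g, 1%g; rewrite mulg1; split=> //; [exact: level_one|exact: (sgl1 Zn_subgroup)].
have [Qs|Zs] : Q1 s \/ Zchi a s.
  case: sS => -[]; [by left|by right| |].
    by move=> /(confiningV c1); rewrite invgK; left.
  move=> [/(sglV Zn_subgroup)]; rewrite invgK chi0V // normrN; by right.
  exists (s * h)%g, z; rewrite mulgA; split=> //; apply: (levelM cP).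
    by apply: (level_leq c1 (leq0n i.+1)); rewrite level0.
  exact: (level_leq c1 (leqnSn i)).
case: Zs => Zs s1; exists (h ^ s^-1)%g, (s * z)%g; split.
- by rewrite conjgE invgK !mulgA mulgVK.
- apply: (level_leq c1 (leq_addl c _)); apply: level_conj => //.
    exact: (sglV Zn_subgroup).
  by rewrite chi0V // lerN2 (le_trans (ler_norm _)).
- exact: (sglM Zn_subgroup).
Qed.

Lemma confiningI P Q : confining a P -> confining a Q -> confining a (P `&` Q).
Proof.
move=> cP cQ; apply: confining_build.
- by move=> h [/(confining_derived cP)].
- by move=> h [/(confiningV cP) ? /(confiningV cQ)].
- by move=> z h Zz z0 [/(confining_conj cP Zz z0) ? /(confining_conj cQ Zz z0)].
- move=> h Dh; have [i iP] := level_exhaust cP Dh; have [j jQ] := level_exhaust cQ Dh.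
  exists (i + j)%N; split; first exact: (level_leq cP (leq_addr j i)).
  exact: (level_leq cQ (leq_addl i j)).
have [i iP] := level_mul_const cP; have [j jQ] := level_mul_const cQ.
exists (i + j)%N => g h [Pg Qg] [Ph Qh]; split.
  by apply: (level_leq cP (leq_addr j i)); exact: iP.
by apply: (level_leq cQ (leq_addl i j)); exact: jQ.
Qed.

End Confining.
Arguments level {R n} a Q k.

(** * Fixers of orbits: lamplike classes and the largest class *)

Section Fixers.
Context {R : realType} {n : nat} (hn : (2 <= n)%N).
Context {a : nat -> F R n} {l r : nat -> R} (ha : standard_elements a l r).
Implicit Types (g h z : F R n) (x y : R) (Q : set (F R n)) (C : set R).

Local Notation A := (a 0%N).
Local Notation r0 := (r 0%N).
Local Notation D := (@derived_subgroup (F R n)).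
Local Notation pull := (pull a).

(** Requiring the whole backward orbit of each point of C to be fixed is what
   makes the set stable under conjugation by A. For C a point these fixers give
   the smallest lamplike classes, for C a half-line the largest class. *)
Definition pull_fixer C : set (F R n) :=
  [set g | D g /\ forall c k, C c -> g (pull k c) = pull k c].

Lemma pull_fixer_subgroup C : subgroup_like (pull_fixer C).
Proof.
split.
- by split=> //; exact: (sgl1 derived_subgroupP).
- move=> g h [Dg gC] [Dh hC]; split; first exact: (sglM derived_subgroupP).
  by move=> c k Cc; rewrite F_mulE gC // hC.
- move=> g [Dg gC]; split; first exact: (sglV derived_subgroupP).
  by move=> c k Cc; rewrite fixV // gC.
Qed.

Lemma fix_conj_pull k g x : (g ^ (A ^+ k))%g x = x <-> g (pull k x) = pull k x.
Proof. by rewrite pullE; exact: fixJ. Qed.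

Lemma level_pull_fixer C k g : level a (pull_fixer C) k g <->
  D g /\ forall c j, C c -> g (pull (k + j) c) = pull (k + j) c.
Proof.
split=> -[Dg gC]; (split=> [|c j Cc]).
- by rewrite -[g](conjgK (A ^+ k)%g); exact: derived_conjg.
- by rewrite addnC pullD; apply/fix_conj_pull; exact: gC.
- exact: derived_conjg.
- by apply/fix_conj_pull; rewrite -pullD addnC; exact: gC.
Qed.

Lemma pull_lt_bound j x u : 0 < u -> x < u -> pull j x < u.
Proof.
move=> u0 xu; have [x0|x0] := leP x 0.
  by apply: le_lt_trans u0; rewrite -(F0 (A^-1 ^+ j)%g) pull_le.
have [xr|rx] := ltP x r0; last by rewrite (pull_fix hn ha).
by apply: le_lt_trans xu; rewrite (pull_leq hn ha _ (leq0n j)) // x0.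
Qed.

Lemma confining_pull_fixer C s : s < r0 -> (forall c, C c -> c <= s) ->
  confining a (pull_fixer C).
Proof.
move=> sr Cs; have [C1 CM CV] := pull_fixer_subgroup C.
apply: (confining_build hn) => //.
- by move=> g [].
- move=> z h Zz /(Zn_nonneg hn ha Zz) [k _ zE] [Dh hC].
  split=> [|c j Cc]; first exact: derived_conjg.
  apply/fixJ; rewrite zE; first by rewrite -pullD; exact: hC.
  by rewrite (pull_le_r hn ha) (le_trans (Cs _ Cc)) // ltW.
- move=> h Dh; have [u u0 hu] := derived_trivial0 hn Dh.
  have [k ks] := pull_small hn ha sr u0.
  exists k; apply/level_pull_fixer; split=> // c j Cc.
  apply: hu; rewrite pullD; apply/ltW/pull_lt_bound => //.
  by apply: le_lt_trans ks; rewrite pull_le Cs.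
by exists 0%N => g h gC hC; rewrite level0; exact: CM.
Qed.

Lemma strictly_confining_pull_fixer C s c : s < r0 -> (forall c, C c -> c <= s) ->
  C c -> 0 < c -> strictly_confining a (pull_fixer C).
Proof.
move=> sr Cs Cc c0; apply/(strictly_confiningP hn ha); split.
  exact: confining_pull_fixer Cs.
have c1 : c < 1 := le_lt_trans (Cs _ Cc) (lt_trans sr (r0_lt1 hn ha)).
have [| | | |p [Dp _ wp]] := @push_derived R n hn 0 c ((c + 1) / 2) 1.
- exact: lexx.
- exact: lexx.
- by rewrite c0.
- by apply/andP; split; lra.
exists p => // -[_ /(_ c 0%N Cc)]; rewrite pull0 => pc.
by move: wp; rewrite pc; lra.
Qed.

Lemma conf_le_sub Q1 Q2 : Q2 `<=` Q1 -> conf_le a Q1 Q2.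
Proof. by move=> Q21; exists 1%N => h /Q21 Qh; apply: word_ball_gen => //; left. Qed.

Lemma pull_fixer_anti C C' : C `<=` C' -> pull_fixer C' `<=` pull_fixer C.
Proof. by move=> CC' g [Dg gC]; split=> // c k /CC'; exact: gC. Qed.

(** If the class of P dominates that of the fixer of the orbit of t, then
   intersecting P with this fixer does not change its class. *)
Lemma LL_iff t (P : strict_conf a) : 0 < t < r0 ->
  LL a t (conf_class P) <-> conf_le a (pull_fixer [set t]) P.
Proof.
move=> /andP[t0 tr]; have le_t c : [set t] c -> c <= t by move=> ->.
have sT := strictly_confining_pull_fixer tr le_t (erefl t) t0.
split=> [[Q [/conf_classP [PQ QP] Qt]]|le_tP].
  apply: conf_le_trans QP; apply: conf_le_sub => q Qq.
  have [cQ _] : strictly_confining a Q by case: Q {PQ Qt} Qq.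
  split=> [|_ k ->]; first exact: (confining_derived cQ).
  apply/fix_conj_pull/Qt; apply: (confining_conj cQ) => //; first exact: (Zn_AX hn).
  by rewrite (chi0_AX hn ha).
have sP : strictly_confining a P by case: P {le_tP}.
have [cP [h Dh nPh]] := (strictly_confiningP hn ha _).1 sP.
have cPT := confiningI hn ha cP sT.1.
have sPT : strictly_confining a (P `&` pull_fixer [set t]).
  by apply/(strictly_confiningP hn ha); split=> //; exists h => // -[].
exists (StrictConf sPT); split; last by move=> q [_ [_ /(_ t 0%N)]]; exact.
apply/conf_classP; split; first by apply: conf_le_sub => q [].
have [k kP] := (conf_le_level hn ha sT.1 cP).1 le_tP.
apply/(conf_le_level hn ha cPT cP); exists k => q Pq; split; last exact: kP.
by apply: (level_leq hn ha cP (leq0n k)); rewrite level0.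
Qed.

(** On elements supported in [t, 1], conjugation by a power A^N agrees with
   conjugation by a fixed f in F'; but the former lowers the level by N and the
   latter changes it by a bounded amount, so the level is bounded. *)
Lemma pull_fixer_largest Q t : 0 < t < r0 -> confining a Q ->
  conf_le a Q (pull_fixer [set c | c <= t]).
Proof.
move=> /andP[t0 tr] cQ; have [c cP] := level_mul_const hn ha cQ.
pose N := (c + c).+1.
have tAt : t <= (A ^+ N)%g t.
  by rewrite -(@pull_le _ _ a N) pushK (pull_leq hn ha _ (leq0n N)) // t0.
have [| | | |f [Df _ fA]] := @derived_cut R n hn (A ^+ N)%g (t / 2) t.
- by exists r0; [exact: (r0_lt1 hn ha)|move=> x; exact: (AX_fix hn ha)].
- lra.
- lra.
- by apply: lt_le_trans tAt; lra.
have fJ g : pull_fixer [set c | c <= t] g -> (g ^ f = g ^ (A ^+ N))%g.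
  move=> [_ gt]; pose k := (f * (A ^+ N)^-1)%g.
  have /commute_sym kg : commute k g.
    apply: disjoint_commute => x; have [tx|xt] := leP t x.
      by left; rewrite F_mulE fA // FK.
    by right; exact: (gt x 0%N (ltW xt)).
  rewrite -[f](mulgVK (A ^+ N)%g) conjgM; congr (_ ^ _)%g.
  by apply/conjg_fixP/commgP.
have [m mf] := level_exhaust hn ha cQ Df.
have level_bound i g : pull_fixer [set c | c <= t] g ->
    level a Q (c + (c + (m + i))) g -> level a Q (c + (c + m)) g.
  elim: i g => [|i IH] g gt; first by rewrite addn0.
  rewrite (_ : c + (c + (m + i.+1)) = m + i + N)%N; last by rewrite /N; lia.
  rewrite levelD -fJ // => gf; apply: IH => //.
  have mf' := level_leq hn ha cQ (leq_addr i m) mf.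
  rewrite (_ : g = f * (g ^ f * f^-1))%g; last by rewrite conjgE !mulgA mulgV mul1g mulgK.
  by apply: (levelM cP); [exact: (level_leq hn ha cQ (leq_addl _ _) mf')|
    apply: (levelM cP) => //; exact: levelV].
have ct : confining a (pull_fixer [set c | c <= t]) by exact: confining_pull_fixer tr _.
apply/(conf_le_level hn ha cQ ct); exists (c + (c + m))%N => g gt.
have [i iP] := level_exhaust hn ha cQ gt.1.
apply: (level_bound i) => //; apply: (level_leq hn ha cQ _ iP).
by rewrite !addnA leq_addl.
Qed.

End Fixers.
Arguments pull_fixer {R n} a C.

(** * Minimality of the fixer of one orbit *)

Section Minimality.
Context {R : realType} {n : nat} (hn : (2 <= n)%N).
Context {a : nat -> F R n} {l r : nat -> R} (ha : standard_elements a l r).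
Implicit Types (g h : F R n) (x z : R) (Q : set (F R n)).

Local Notation A := (a 0%N).
Local Notation r0 := (r 0%N).
Local Notation D := (@derived_subgroup (F R n)).
Context {t : R} (ht : 0 < t < r0).

Local Notation y k := (pull a k t).

(** The levels of the fixer of the orbit of t. The points y j decrease to 0, so
   this is a condition near 0. *)
Definition tail_fixer i : set (F R n) :=
  [set g | D g /\ forall j, (i <= j)%N -> g (y j) = y j].

Lemma tail_fixerE i : tail_fixer i = level a (pull_fixer a [set t]) i.
Proof.
apply/seteqP; split=> g.
  by move=> [Dg gi]; apply/level_pull_fixer; split=> // _ j ->; apply: gi; exact: leq_addr.
move=> /level_pull_fixer [Dg gi]; split=> // j /subnKC <-.
exact: gi.
Qed.

Section Climb.
Variables (W : set (F R n)) (M : nat).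
Hypothesis tailW : tail_fixer M `<=` W.
Hypothesis moveW : forall i, exists q, [/\ W q, D q,
  forall j, (i < j)%N -> q (y j) = y j & y i < q (y i)].

(** Climbing past one orbit point y i takes two letters: an element of the tail
   fixer supported between y i.+1 and y i, bringing x close to y i, and an
   element moving y i. *)
Lemma climb K x : y (M + K) < x -> exists u, [/\ word_ball W (2 * K) u, D u,
  forall j, (M + K <= j)%N -> u (y j) = y j & y M < u x].
Proof.
elim: K x => [|K IH] x.
  rewrite addn0 => yx; exists 1%g; split=> //; first exact: word_ball1.
  exact: (sgl1 derived_subgroupP).
rewrite addnS; set i := (M + K)%N in IH * => yx.
have [q [Wq Dq qj qi]] := moveW i.
have yi : y i.+1 < y i by exact: (pullS_lt hn ha).
have qi' : (q^-1)%g (y i) < y i by rewrite -(Flt q) FVK.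
(* z is to be moved past w, and w past y i by q. *)
have [z [z1 z2 zx]] : exists z, [/\ y i.+1 < z, z < y i & z <= x].
  exists (Num.min x ((y i.+1 + y i) / 2)); rewrite lt_min gt_min ge_min lexx yx.
  by split=> //; [|apply/orP; right]; lra.
have [w [w1 w2 wq]] : exists w, [/\ y i.+1 < w, w < y i & (q^-1)%g (y i) < w].
  exists (Num.max ((y i.+1 + y i) / 2) (((q^-1)%g (y i) + y i) / 2)).
  rewrite !lt_max gt_max; split; last by apply/orP; right; lra.
    by apply/orP; left; lra.
  by apply/andP; split; lra.
have y0 j : 0 <= y j by apply: ltW; rewrite pull_gt0; case/andP: ht.
have y1 j : y j <= 1.
  rewrite F_le1; case/andP: ht => _ /ltW/le_trans; apply; exact: ltW (r0_lt1 hn ha).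
have [| |||p [Dp pid wp]] := @push_derived R n hn (y i.+1) z w (y i) => //.
- by rewrite z1.
- by rewrite w1.
have py j : p (y j) = y j.
  apply: pid; have [ij|ji] := ltnP i j; [left|right]; exact: (pull_leq hn ha).
have Wp : W p by apply: tailW; split.
have [|u [uW Du uj ux]] := IH (q (p x)).
  by rewrite -[y i](FVK q) Flt (lt_le_trans wq) // (le_trans wp) // Fle.
exists (p * (q * u))%g; split.
- rewrite mulnS (_ : 2 + 2 * K = 1 + (1 + 2 * K))%N //.
  apply: word_ball_mul; first exact: word_ball_gen.
  by apply: word_ball_mul => //; exact: word_ball_gen.
- by do ! apply: (sglM derived_subgroupP) => //.
- by move=> j ij; rewrite !F_mulE py qj // uj // ltnW.
- by rewrite !F_mulE.
Qed.

(** Both g u and v carry all of y M, ..., y (M + K) beyond y M, where derived_cut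
   can match the two configurations by a single element p of the tail fixer. *)
Lemma tail_fixer_word K : tail_fixer (M + K.+1) `<=` word_ball W (4 * K + 6).
Proof.
move=> g [Dg gj]; rewrite addnS in gj; pose Y := y (M + K).
have YS : y (M + K).+1 < Y by exact: (pullS_lt hn ha).
have [|u [uW Du uj uY]] := @climb K.+1 (g Y).
  by rewrite addnS -(gj _ (leqnn _)) Flt.
have [|v [vW Dv vj vY]] := @climb K.+1 Y; first by rewrite addnS.
rewrite addnS in uj vj.
pose h := (v^-1 * (g * u))%g.
have Dh : D h.
  by do ! apply: (sglM derived_subgroupP) => //; exact: (sglV derived_subgroupP).
have [| | | |p [Dp pid ph]] := @derived_cut R n hn h (y M) (v Y).
- exact: derived_trivial1.
- by apply: ltW; rewrite pull_gt0; case/andP: ht.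
- exact: vY.
- by rewrite !F_mulE FK.
have Wp : W p.
  by apply: tailW; split=> // j Mj; apply: pid; exact: (pull_leq hn ha).
pose g0 := (g * u * p^-1 * v^-1)%g.
have Wg0 : W g0.
  apply: tailW; split.
    by do ! apply: (sglM derived_subgroupP) => //; exact: (sglV derived_subgroupP).
  move=> j Mj; rewrite !F_mulE; have [jK|Kj] := leqP j (M + K).
    have -> : u (g (y j)) = p (v (y j)).
      by rewrite ph ?F_mulE ?FK // Fle; exact: (pull_leq hn ha).
    by rewrite !FK.
  rewrite gj // uj // [(p^-1)%g _]fixV; first by rewrite fixV // vj.
  by apply: pid; exact: (pull_leq hn ha).
have -> : g = (g0 * v * p * u^-1)%g by rewrite /g0 mulgVK mulgVK mulgK.
rewrite (_ : 4 * K + 6 = 1 + 2 * K.+1 + 1 + 2 * K.+1)%N; last by lia.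
apply: word_ball_mul; last exact: word_ball_inv.
apply: word_ball_mul; last exact: word_ball_gen.
by apply: word_ball_mul => //; exact: word_ball_gen.
Qed.

End Climb.

Lemma exp_beats_linear c : exists L, (4 * (c * L) + 6 <= 2 ^ L)%N.
Proof.
pose m := (8 * c + 6)%N; exists (m + m)%N.
have m2 : (m.+1 <= 2 ^ m)%N by exact: ltn_expl.
have := leq_mul m2 m2; rewrite -expnD; apply: leq_trans.
rewrite /m; nia.
Qed.

(** Words of length linear in K sit only logarithmically many levels up, so the
   level of the tail fixers grows more slowly than one unit per orbit point;
   as it is exactly equivariant, it does not grow at all. *)
Lemma moving_confining_full Q : confining a Q -> conf_le a Q (pull_fixer a [set t]) ->
  (forall i, exists q, [/\ Q q, forall j, (i < j)%N -> q (y j) = y j & y i < q (y i)]) ->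
  forall h, D h -> Q h.
Proof.
move=> cQ; have tr : t < r0 by case/andP: ht.
have cT : confining a (pull_fixer a [set t]).
  by apply: (confining_pull_fixer hn ha tr) => c ->.
move=> /(conf_le_level hn ha cQ cT) [k0 k0P] Qmove.
have [c cP] := level_mul_const hn ha cQ.
have [L LP] := exp_beats_linear c.
have tailP M : tail_fixer M `<=` level a Q k0.
  elim: M => [|M IH] g; first by rewrite tail_fixerE level0; exact: k0P.
  (* Conjugation by A^-(c L) moves g to a tail c L + 1 points beyond M, where it
     is a word of length at most 2^L; conjugating back compensates for the c L
     levels that this word may climb. *)
  rewrite tail_fixerE -[g](conjgKV (A ^+ (c * L))%g) -levelD -tail_fixerE.
  rewrite addSn -addnS => gM; rewrite -levelD addnC.
  have moveW i : exists q, [/\ level a Q k0 q, D q,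
      forall j, (i < j)%N -> q (y j) = y j & y i < q (y i)].
    have [q [Qq qj qi]] := Qmove i; exists q; split=> //; last exact: (confining_derived cQ).
    by apply: (level_leq hn ha cQ (leq0n k0)); rewrite level0.
  apply: (level_word hn ha cQ cP); apply: (word_ball_sub (@subset_refl _ _) LP).
  exact: (tail_fixer_word IH moveW gM).
move=> h Dh.
have Dh' : D (h ^ (A ^+ k0)^-1)%g by exact: derived_conjg.
have [M MP] := level_exhaust hn ha cT Dh'.
have := tailP M (h ^ (A ^+ k0)^-1)%g; rewrite tail_fixerE => /(_ MP).
by rewrite /level /= conjgKV.
Qed.

(** If Q does not fix a tail of the orbit of t, it has elements q moving points
   y N with N arbitrarily large. Taking N maximal for q and conjugating by a power
   of A gives elements of Q that move a prescribed y i and fix all later points;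
   then Q is all of F'. *)
Lemma pull_fixer_minimal Q : strictly_confining a Q -> conf_le a Q (pull_fixer a [set t]) ->
  conf_le a (pull_fixer a [set t]) Q.
Proof.
move=> /(strictly_confiningP hn ha) [cQ [h Dh nQh]] le_Qt; apply: contrapT => nle.
have /andP[t0 tr] := ht.
have cT : confining a (pull_fixer a [set t]).
  by apply: (confining_pull_fixer hn ha tr) => c ->.
apply: nQh; apply: moving_confining_full Dh => // i.
have [q [Qq [N iN qN]]] : exists q, Q q /\ exists2 N, (i <= N)%N & q (y N) != y N.
  apply: contrapT => noq; apply: nle; apply/(conf_le_level hn ha cT cQ); exists i => q Qq.
  rewrite -tail_fixerE; split=> [|j ij]; first exact: (confining_derived cQ).
  apply: contrapT => /eqP qj; apply: noq; exists q; split=> //; by exists j.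
have [m mP] : exists m, forall j, q (y j) != y j -> (j <= m)%N.
  have [u u0 qu] := derived_trivial0 hn (confining_derived cQ Qq).
  have [m mu] := pull_small hn ha tr u0; exists m => j; apply: contraNleq => mj.
  by apply/eqP/qu; apply: le_trans (ltW mu); exact/ltW/(pull_ltn hn ha).
have exN : exists j, q (y j) != y j by exists N.
case: (ex_maxnP exN mP) => N' qN' maxN'.
have iN' : (i <= N')%N := leq_trans iN (maxN' _ qN).
pose p := (q ^ (A ^+ (N' - i)))%g.
have Qp : Q p.
  apply: (confining_conj cQ) => //; first exact: (Zn_AX hn).
  by rewrite (chi0_AX hn ha).
have pj j : (i < j)%N -> p (y j) = y j.
  move=> ij; apply/fix_conj_pull; rewrite -pullD; apply/eqP/negPn/negP => /maxN'.
  by lia.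
have pi : p (y i) != y i.
  by apply/negP => /eqP /fix_conj_pull; rewrite -pullD subnKC //; apply/eqP.
have [up|dn|/esym/eqP] := ltgtP (y i) (p (y i)); last by rewrite (negPf pi).
  by exists p.
exists p^-1%g; split; first exact: (confiningV cQ).
  by move=> j /pj pE; rewrite fixV.
by rewrite -(Flt p) FVK.
Qed.

End Minimality.

(** * Separating fixers, and copies of the power set *)

Section Separation.
Context {R : realType} {n : nat} (hn : (2 <= n)%N).
Context {a : nat -> F R n} {l r : nat -> R} (ha : standard_elements a l r).
Context {t0 : R} (ht0 : 0 < t0 < r 0%N).
Implicit Types (g h : F R n) (x u v : R) (C : set R).

Local Notation A := (a 0%N).
Local Notation r0 := (r 0%N).
Local Notation pull := (pull a).

Lemma domain_lt_r x : x < A t0 -> x < r0.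
Proof.
move=> xA; apply: (lt_trans xA); rewrite -[X in _ < X](AX_fix hn ha 1 (lexx r0)) Flt.
by case/andP: ht0.
Qed.

(** The translates of C other than C itself lie outside the fundamental domain
   [t0, A t0[, so a push supported in a translate of ]u, v[ moves a point of the
   orbit of x while fixing all orbits of points of C. *)
Lemma pull_fixer_separate C C' be s x u v : (forall c, C c -> t0 <= c <= be) ->
  t0 <= be < A t0 -> t0 <= x < A t0 -> u < x < v ->
  (forall c, C c -> c <= u \/ v <= c) ->
  s < r0 -> (forall c, C' c -> c <= s) -> C' x ->
  ~ conf_le a (pull_fixer a C') (pull_fixer a C).
Proof.
move=> CP /andP[tbe beA] /andP[tx xA] /andP[ux xv] Cuv sr C's C'x.
have [t00 t0r] := andP ht0.
have cC : confining a (pull_fixer a C).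
  by apply: (confining_pull_fixer hn ha (domain_lt_r beA)) => c /CP/andP[].
have cC' : confining a (pull_fixer a C') by exact: (confining_pull_fixer hn ha sr C's).
move=> /(conf_le_level hn ha cC' cC) [k kP].
have pullA j : pull j.+1 (A t0) = pull j t0.
  by rewrite -add1n pullD -[A t0]/((A ^+ 1)%g t0) pushK.
pose u1 := Num.max u (pull 1 be); pose v1 := Num.min v (A t0).
have u1x : u1 < x.
  by rewrite gt_max ux (lt_le_trans _ tx) // -(@pull0 _ _ a t0) -pullA pull_lt.
have xv1 : x < v1 by rewrite lt_min xv.
have u10 : 0 <= u1.
  by rewrite le_max; apply/orP; right; rewrite ltW // pull_gt0 (lt_le_trans t00).
have v11 : v1 <= 1.
  rewrite ge_min; apply/orP; right; rewrite F_le1.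
  exact: ltW (lt_trans t0r (r0_lt1 hn ha)).
have kx : pull k x < pull k v1 by rewrite pull_lt.
have [| | | |p [Dp pid wp]] :=
  @push_derived R n hn (pull k u1) (pull k x) ((pull k x + pull k v1) / 2) (pull k v1).
- by rewrite F_ge0.
- by rewrite F_le1.
- by rewrite !pull_lt u1x.
- by have : pull k u1 < pull k x; [rewrite pull_lt|move=> ?; apply/andP; split; lra].
have /kP /level_pull_fixer [_ /(_ x 0%N C'x)] : pull_fixer a C p.
  split=> // c i Cc; apply: pid; have /andP[tc cbe] := CP _ Cc.
  have cr : 0 < c < r0.
    by rewrite (lt_le_trans t00 tc) (le_lt_trans cbe) // domain_lt_r.
  have ber : 0 < be < r0 by rewrite (lt_le_trans t00 tbe) domain_lt_r.
  have [ik|ki|->] := ltngtP i k.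
  - right; case: k ik {kP kx wp} => // k ik.
    apply: (@le_trans _ _ (pull k.+1 (A t0))); first by rewrite pull_le ge_min lexx orbT.
    rewrite pullA; apply: (@le_trans _ _ (pull i t0)); last by rewrite pull_le.
    exact: (pull_leq hn ha).
  - left; apply: (@le_trans _ _ (pull k.+1 be)); last first.
      by rewrite -add1n pullD pull_le le_max lexx orbT.
    apply: (@le_trans _ _ (pull i be)); first by rewrite pull_le.
    exact: (pull_leq hn ha).
  - by case: (Cuv _ Cc) => cuv; [left|right]; rewrite pull_le ?le_max ?ge_min cuv.
by rewrite addn0 => px; move: wp; rewrite px; lra.
Qed.

Lemma pull_fixer1_separate x y : t0 <= x < A t0 -> t0 <= y < A t0 -> x != y ->
  ~ conf_le a (pull_fixer a [set x]) (pull_fixer a [set y]).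
Proof.
move=> xI yI xy; have [tx xA] := andP xI; have [ty yA] := andP yI.
have xr : x < r0 := domain_lt_r xA.
case: (ltgtP x y) xy => // [lt_xy|lt_yx] _.
  apply: (@pull_fixer_separate _ _ y x x (x - 1) y) => //.
  - by move=> c ->; rewrite ty lexx.
  - by rewrite lt_xy andbT; lra.
  - by move=> c ->; right.
  - by move=> c ->.
apply: (@pull_fixer_separate _ _ y x x y (x + 1)) => //.
- by move=> c ->; rewrite ty lexx.
- by rewrite lt_yx /=; lra.
- by move=> c ->; left.
- by move=> c ->.
Qed.

Section Powerset.
Variables (al be : R) (E : set R) (e0 : R).
Hypotheses (tal : t0 <= al) (albe : al < be) (beA : be < A t0).
Hypotheses (Ee0 : E e0) (EP : forall e, E e -> t0 <= e <= al).

Let step (m : nat) : R := be - (be - al) / m.+1%:R.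

Let step_lt i j : (i < j)%N -> step i < step j.
Proof.
move=> ij; rewrite ltrD2l ltrN2 ltr_pM2l ?subr_gt0 //.
by rewrite ltf_pV2 ?posrE ?ltr0n // ltr_nat ltnS.
Qed.

Let step_ge m : al <= step m.
Proof.
have s0 : step 0 = al by rewrite /step divr1 subKr.
by rewrite -{1}s0; case: m => // m; apply/ltW/step_lt.
Qed.

Let step_le m : step m <= be.
Proof. by rewrite gerBl divr_ge0 // subr_ge0 ltW. Qed.

(** The points step m.+1 are isolated from one another and from E, so that the
   fixers of these sets compare as the index sets B do. *)
Definition marked_points (B : set nat) : set R := E `|` [set step m.+1 | m in B].

Lemma marked_pointsP B c : marked_points B c -> t0 <= c <= be.
Proof.
case=> [/EP/andP[-> cal]|[m _ <-]]; first exact: le_trans (ltW albe).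
by rewrite (le_trans tal (step_ge _)) step_le.
Qed.

Lemma marked_points_gt B c : marked_points B c -> E c \/ al <= c.
Proof. by case=> [|[m _ <-]]; [left|right; exact: step_ge]. Qed.

Let ber : be < r0. Proof. exact: domain_lt_r. Qed.

Lemma marked_points_strict B : strictly_confining a (pull_fixer a (marked_points B)).
Proof.
apply: (strictly_confining_pull_fixer hn ha ber) (_ : marked_points B e0) _.
- by move=> c /marked_pointsP/andP[].
- by left.
- by have /andP[te _] := EP Ee0; apply: lt_le_trans te; case/andP: ht0.
Qed.

Lemma powerset_copy (S : set (Conf a)) :
  (forall B, S (conf_class (StrictConf (marked_points_strict B)))) ->
  contains_powerset_nat S.
Proof.
move=> SP; exists (fun B => conf_class (StrictConf (marked_points_strict B))).
split=> // B B'; apply: (iff_trans (Conf_leE _ _)); split=> /= [le_BB' m Bm|BB'].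
  apply: contrapT => B'm.
  apply: (@pull_fixer_separate _ _ be be (step m.+1) (step m) (step m.+2)) le_BB'.
  - exact: marked_pointsP.
  - by rewrite (le_trans tal (ltW albe)).
  - by rewrite (le_trans tal (step_ge m.+1)) (le_lt_trans (step_le _) beA).
  - by apply/andP; split; apply: (step_lt (ltnSn _)).
  - move=> c [/EP/andP[_ cal]|[j B'j <-]]; first by left; exact: le_trans (step_ge _).
    have [jm|mj|jm] := ltngtP j m; last by rewrite jm in B'j.
      by left; move: jm; rewrite leq_eqVlt => /orP[/eqP <- //|/step_lt/ltW].
    right; move: mj; rewrite leq_eqVlt => /orP[/eqP <- //|mj].
    by apply/ltW/step_lt.
  - exact: ber.
  - by move=> c /marked_pointsP/andP[].
  - by right; exists m.
apply/conf_le_sub/pull_fixer_anti => c [Ec|[m Bm <-]]; first by left.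
by right; exists m => //; exact: BB'.
Qed.

End Powerset.

End Separation.

Theorem theorem3 (R : realType) (n : nat) (hn : (2 <= n)%N)
    (a : nat -> F R n) (l r : nat -> R) (ha : standard_elements a l r)
    (t0 : R) (ht0 : 0 < t0 < r 0%N) :
  let I : set R := `[t0, a 0%N t0[%classic in
  [/\ exists M : Conf a, is_largest setT M,
      ~ countable [set LL a t | t in I],
      (forall t, I t -> is_upper (LL a t)) /\
      (forall t, I t -> forall M : Conf a, is_largest setT M -> LL a t M) /\
      (exists mu : R -> Conf a,
        (forall t, I t -> is_smallest (LL a t) (mu t) /\ is_minimal (mu t)) /\
        (forall t t', I t -> I t' -> t != t' ->
           mu t <> mu t' /\ (mu t >< mu t')%O)) &
      (forall t, I t -> contains_powerset_nat (LL a t)) /\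
      (forall t t', I t -> I t' -> t != t' ->
        [/\ contains_powerset_nat (LL a t `\` LL a t'),
            contains_powerset_nat (LL a t' `\` LL a t) &
            contains_powerset_nat (LL a t `&` LL a t')])].
Proof.
move=> I.
have [t00 t0r] := andP ht0.
have IE t : I t -> t0 <= t < a 0%N t0 by rewrite /I /= in_itv.
have Ir t : I t -> 0 < t < r 0%N.
  by move=> /IE/andP[tt tA]; rewrite (lt_le_trans t00 tt) (domain_lt_r hn ha ht0).
have strict_repr (x : Conf a) : strictly_confining a (repr x) by case: (repr x).
have sT t : 0 < t < r 0%N -> strictly_confining a (pull_fixer a [set t]).
  move=> /andP[t_gt0 tr].
  by apply: (strictly_confining_pull_fixer hn ha tr _ (erefl t)) => // c ->.
(* Outside ]0, r 0[ the class at t0 serves as a default value. *)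
have /choice [mu muP] : forall t, exists m : Conf a, 0 < t < r 0%N ->
    exists sP : strictly_confining a (pull_fixer a [set t]), m = conf_class (StrictConf sP).
  move=> t; have [tr|ntr] := boolP (0 < t < r 0%N).
    by exists (conf_class (StrictConf (sT t tr))) => _; exists (sT t tr).
  by exists (conf_class (StrictConf (sT t0 ht0))) => tr; case/negP: ntr.
have LLmu t x : I t -> LL a t x <-> (mu t <= x)%O.
  move=> It; have [sP ->] := muP t (Ir t It); rewrite -[x]conf_classK.
  have LLx := LL_iff hn ha (repr x) (Ir t It).
  exact: (iff_trans LLx (iff_sym (Conf_leE (StrictConf sP) (repr x)))).
have mu_incomp t t' : I t -> I t' -> t != t' -> ~~ (mu t <= mu t')%O.
  move=> It It' tt'; apply/negP.
  have [sP ->] := muP t (Ir t It); have [sP' ->] := muP t' (Ir t' It').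
  by move=> /Conf_leE; exact: (pull_fixer1_separate hn ha ht0 (IE _ It) (IE _ It')).
have LL_inj t t' : I t -> I t' -> LL a t = LL a t' -> t = t'.
  move=> It It' LLE; apply: contrapT => /eqP; rewrite eq_sym.
  move=> /(mu_incomp _ _ It' It)/negP; apply.
  by apply/(LLmu _ _ It'); rewrite -LLE; apply/(LLmu _ _ It).
have copies t t' : I t -> I t' -> t != t' ->
    contains_powerset_nat (LL a t `\` LL a t') /\ contains_powerset_nat (LL a t `&` LL a t').
  move=> It It' tt'; have [tI tI'] := (IE _ It, IE _ It').
  have [/andP[tt tA] /andP[tt0 tA']] := (tI, tI').
  have [al [tal tal' alA]] : exists al, [/\ t < al, t' < al & al < a 0%N t0].
    exists ((Num.max t t' + a 0%N t0) / 2).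
    have mA : Num.max t t' < a 0%N t0 by rewrite gt_max tA.
    have [] : t <= Num.max t t' /\ t' <= Num.max t t' by rewrite !le_max !lexx orbT.
    by split; lra.
  have [be [albe beA]] : exists be, al < be /\ be < a 0%N t0.
    by exists ((al + a 0%N t0) / 2); split; lra.
  have t0al : t0 <= al := le_trans tt (ltW tal).
  have in_LL E (e : R) sP : I e -> E e ->
      LL a e (conf_class (@StrictConf _ _ a (pull_fixer a E) sP)).
    move=> Ie Ee; apply/(LL_iff hn ha _ (Ir e Ie)).
    by apply/conf_le_sub/pull_fixer_anti => _ ->.
  split.
    have EP e : [set t] e -> t0 <= e <= al by move=> ->; rewrite tt ltW.
    apply: (@powerset_copy _ _ hn _ _ _ ha _ ht0 _ _ [set t] t
      t0al albe beA (erefl t) EP) => B.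
    split; first by apply: in_LL => //; left.
    move=> /(LL_iff hn ha _ (Ir t' It')) /=.
    (* t' is separated from t on one side and from the sequence by al. *)
    have sep u v : u < t' < v -> t <= u \/ v <= t -> v <= al ->
        ~ conf_le a (pull_fixer a [set t']) (pull_fixer a (marked_points al be [set t] B)).
      move=> ut'v tuv val.
      apply: (@pull_fixer_separate _ _ hn _ _ _ ha _ ht0 _ _ be t' t' u v) => //.
      - exact: (marked_pointsP t0al albe EP).
      - by rewrite (le_trans t0al (ltW albe)).
      - by move=> c /(marked_points_gt albe)[-> //|alc]; right; exact: le_trans alc.
      - exact: (domain_lt_r hn ha ht0 tA').
      - by move=> c ->.
    case: (ltgtP t t') tt' => // [lt_tt'|lt_t't] _.
      by apply: (sep t al); rewrite ?lt_tt' ?tal' ?lexx //; left.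
    by apply: (sep (t' - 1) t); [apply/andP; split; lra|right|exact: ltW].
  have EP e : [set t; t'] e -> t0 <= e <= al by case=> ->; rewrite ?tt ?tt0 ltW.
  apply: (@powerset_copy _ _ hn _ _ _ ha _ ht0 _ _ [set t; t'] t
    t0al albe beA (or_introl (erefl t)) EP) => B.
  by split; apply: in_LL => //; left; [left|right].
split.
- have sM : strictly_confining a (pull_fixer a [set c | c <= t0]).
    exact: (strictly_confining_pull_fixer hn ha t0r _ (lexx t0) t00).
  exists (conf_class (StrictConf sM)); split=> // x _; rewrite -[x]conf_classK; apply/Conf_leE.
  exact: (pull_fixer_largest hn ha ht0 (strict_repr x).1).
- move=> cLL; have cI : countable I.
    rewrite (eq_countable (_ : (I #= [set LL a t | t in I])%card)) // card_eq_sym.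
    by apply: inj_card_eq => t t' /set_mem It /set_mem It'; exact: LL_inj.
  have := countable_lebesgue_measure0 cI; rewrite lebesgue_measure_itv /= lte_fin.
  have tA : t0 < a 0%N t0 by exact: (A_gt hn ha).
  by rewrite tA -EFinB => -[] /eqP; rewrite subr_eq0 gt_eqF.
- split.
    move=> t It x y /(LLmu _ _ It) tx xy; apply/(LLmu _ _ It).
    exact: le_trans xy.
  split; first by move=> t It M [_ MP]; apply/(LLmu _ _ It); exact: MP.
  exists mu; split=> [t It|t t' It It' tt'].
    split; first by split=> [|x /(LLmu _ _ It) //]; apply/(LLmu _ _ It).
    move=> x xmu; apply/eqP; rewrite eq_le xmu /=.
    move: xmu; have [sP ->] := muP t (Ir t It); rewrite -[x]conf_classK => /Conf_leE xmu.
    apply/Conf_leE; exact: (pull_fixer_minimal hn ha (Ir t It) (strict_repr x) xmu).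
  have le1 := mu_incomp _ _ It It' tt'.
  have le2 : ~~ (mu t' <= mu t)%O by apply: mu_incomp => //; rewrite eq_sym.
  split; first by move=> e; rewrite e lexx in le1.
  by rewrite /Order.comparable negb_or le1.
- split=> [t It|t t' It It' tt'].
    have /andP[tt tA] := IE _ It; pose t' := (t + a 0%N t0) / 2.
    have It' : I t' by rewrite /I /= in_itv /= /t'; apply/andP; split; lra.
    have tt' : t != t' by rewrite lt_eqF // /t'; lra.
    have [[f [fS fE]] _] := copies _ _ It It' tt'.
    by exists f; split=> // B; have [] := fS B.
  have [? ?] := copies _ _ It It' tt'; split=> //.
  by have [] := copies _ _ It' It; rewrite 1?eq_sym.
Qed.
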